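(* Let $\mathbf{A} = \mathbf{B} + \mathbf{E}$ with $\mathbf{A}, \mathbf{B}, \mathbf{E} \in \mathrm{H}^{m \times n}$ and $\mathbf{B} \neq 0$, and let $I \subseteq [m]$, $J \subseteq [n]$. Denote $\mathbf{C} = \mathbf{A}(:,J)$, $\mathbf{R} = \mathbf{A}(I,:)$, $\mathbf{G} = \mathbf{A}(I,J)$, $\mathbf{G}_{\mathbf{B}} = \mathbf{B}(I,J)$, $\mathbf{C}_{\mathbf{E}} = \mathbf{E}(:,J)$, $\mathbf{R}_{\mathbf{E}} = \mathbf{E}(I,:)$, $\mathbf{G}_{\mathbf{E}} = \mathbf{E}(I,J)$. Let $\mathbf{B} = \mathbf{U} \Sigma V^*$ be an SVD and assume $\mathrm{rank}_{\mathrm{c}}(\mathbf{G}_{\mathbf{B}}) = \mathrm{rank}_{\mathrm{c}}(\mathbf{B})$. Let $\|\cdot\|_{\phi}$ be the unitarily invariant norm induced by a symmetric gauge function $\phi$. Denote $\eta_r = \|\mathbf{U}(I,:)^\dagger\|_{\ell_2(\mathrm{H}) \to \ell_2}$ and $\eta_c = \|(V(J,:)^* )^\dagger\|_{\ell_2 \to \ell_2}$. Then $$\begin{aligned} \|\mathbf{B} - \mathbf{C} \mathbf{G}^\dagger \mathbf{R}\|_{\phi} &\leq \eta_r \|\mathbf{R}_{\mathbf{E}}\|_{\phi} + \eta_c \|\mathbf{C}_{\mathbf{E}}\|_{\phi} + 3 \eta_r \eta_c \|\mathbf{G}_{\mathbf{E}}\|_{\phi} \\ &\quad + \|\mathbf{G}^\dagger\|_{\ell_2(\mathrm{H})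 \to \ell_2} \Big( \|\mathbf{R}_{\mathbf{E}}\|_{\phi} \|\mathbf{C}_{\mathbf{E}}\|_{\phi} + \big(\eta_r \|\mathbf{R}_{\mathbf{E}}\|_{\phi} + \eta_c \|\mathbf{C}_{\mathbf{E}}\|_{\phi} + \eta_r \eta_c \|\mathbf{G}_{\mathbf{E}}\|_{\phi}\big) \|\mathbf{G}_{\mathbf{E}}\|_{\phi} \Big). \end{aligned}$$
   Context: Let $\mathbb{F} \in \{\mathbb{R}, \mathbb{C}\}$ and let $\mathrm{H}$ be a Hilbert space over $\mathbb{F}$ with inner product linear in the second argument. A Bochner matrix $\mathbf{A} \in \mathrm{H}^{m \times n}$ is an $m \times n$ array with entries in $\mathrm{H}$; classical matrices have entries in $\mathbb{F}$. $[n] = \{1,\ldots,n\}$; $\mathbf{A}(I,J)$ is the submatrix with rows $I$ and columns $J$, and '':'' means all indices. The space $\mathrm{H}^m$ is a Hilbert space with inner product $\sum_i \langle x_i, y_i\rangle_{\mathrm{H}}$ and norm $\|\cdot\|_{\ell_2(\mathrm{H})}$; $\mathbb{F}^n$ has the Euclidean norm $\ell_2$. A Bochner matrix $\mathbf{A}$ is identified with the bounded finite-rank operator $\mathbb{F}^n \to \mathrm{H}^m$, $x \mapsto \mathbf{A}x$ (usual matrix-vector rule); $\mathrm{rank}_{\mathrm{c}}(\mathbf{A}) = \mathrm{rank}(\mathbf{A})$ is the rank of this operator; $\mathbf{A}^* : \mathrm{H}^m \to \mathbb{F}^n$ is its adjoint and $\mathbf{A}^\dagger : \mathrm{H}^m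 \to \mathbb{F}^n$ its Moore--Penrose pseudoinverse. Operators $\mathrm{H}^m \to \mathbb{F}^n$ are applied to Bochner matrices columnwise, so $\mathbf{G}^\dagger \mathbf{R}$ is a classical $|J| \times n$ matrix. A Bochner matrix $\mathbf{U}$ has orthonormal columns if $\mathbf{U}^*\mathbf{U}$ is the identity matrix. An SVD of a nonzero $\mathbf{B} \in \mathrm{H}^{m\times n}$ with $r = \mathrm{rank}(\mathbf{B})$ is $\mathbf{B} = \mathbf{U}\Sigma V^*$ with $\mathbf{U} \in \mathrm{H}^{m \times r}$, $V \in \mathbb{F}^{n \times r}$ having orthonormal columns and $\Sigma = \mathrm{diag}(\sigma_1,\ldots,\sigma_r)$, $\sigma_1 \ge \cdots \ge \sigma_r > 0$; set $\sigma_j(\mathbf{B}) = 0$ for $j > r$. Symmetric gauge functions $\phi$ are normalized, $\phi(1,0,\ldots,0)=1$, and define a norm for Bochner matrices of any size by $\|\mathbf{A}\|_\phi = \phi(\sigma_1(\mathbf{A}), \sigma_2(\mathbf{A}), \ldots)$ (singular values padded by zeros). Subscripts such as $\|\cdot\|_{\ell_2(\mathrm{H}) \to \ell_2}$ and $\|\cdot\|_{\ell_2\to\ell_2}$ denote operator norms. *)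

(* Defs.v *)
From HB Require Import structures.
From mathcomp Require Import all_boot all_order all_algebra.
From mathcomp Require Import boolp classical_sets reals topology normedtype.
From mathcomp Require Import complex.

Set Implicit Arguments.
Unset Strict Implicit.
Unset Printing Implicit Defensive.

Import Order.TTheory GRing.Theory Num.Theory.
Import numFieldNormedType.Exports.

Local Open Scope classical_set_scope.
Local Open Scope ring_scope.

Inductive scalar_kind := RealScalars | ComplexScalars.

Definition scalars (R : realType) (k : scalar_kind) : numFieldType :=
  match k with RealScalars => R | ComplexScalars => complex R end.

Definition sconj (R : realType) (k : scalar_kind) :
    scalars R k -> scalars R k :=
  match k with RealScalars => fun x => x | ComplexScalars => fun x => conjc x end.

Definition sre (R : realType) (k : scalar_kind) : scalars R k -> R :=
  match k with RealScalars => fun x => x | ComplexScalars => fun x => complex.Re x end.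

Definition of_real (R : realType) (k : scalar_kind) : R -> scalars R k :=
  match k with RealScalars => fun x => x | ComplexScalars => fun x => Complex x 0 end.

(* Hilbert spaces: the inner product is linear in its second argument and
   induces the norm of the complete normed module. *)
HB.mixin Record CompleteNormedModule_isHilbert (R : realType)
    (k : scalar_kind) H of CompleteNormedModule (scalars R k) H := {
  inner : H -> H -> scalars R k ;
  inner_linearr : forall (x y z : H) (a : scalars R k),
    inner x (a *: y + z) = a * inner x y + inner x z ;
  inner_conj : forall x y : H, inner y x = sconj (inner x y) ;
  inner_norm : forall x : H, inner x x = `|x| ^+ 2 }.

#[short(type="hilbertType")]
HB.structure Definition Hilbert (R : realType) (k : scalar_kind) :=
  { H of CompleteNormedModule (scalars R k) H &
         CompleteNormedModule_isHilbert R k H }.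

Section InnerProductOperators.
Variables (R : realType) (k : scalar_kind).
Local Notation F := (scalars R k).
Implicit Types U V : lmodType F.

Definition dot_norm V (dot : V -> V -> F) (x : V) : R :=
  Num.sqrt (sre (dot x x)).

Definition op_norm U V (dotU : U -> U -> F) (dotV : V -> V -> F)
    (T : U -> V) : R :=
  sup [set dot_norm dotV (T x) | x in [set x | dot_norm dotU x <= 1]].

(* The four Penrose equations. *)
Definition is_pinv U V (dotU : U -> U -> F) (dotV : V -> V -> F)
    (T : U -> V) (S : V -> U) : Prop :=
  [/\ (forall (a : F) (y z : V), S (a *: y + z) = a *: S y + S z),
      (forall x, T (S (T x)) = T x),
      (forall y, S (T (S y)) = S y),
      (forall y z, dotV (T (S y)) z = dotV y (T (S z))) &
      (forall x z, dotU (S (T x)) z = dotU x (S (T z)))].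

(* The default value is irrelevant: every operator of finite rank considered
   here has exactly one Moore-Penrose pseudoinverse. *)
Definition pinv U V (dotU : U -> U -> F) (dotV : V -> V -> F)
    (T : U -> V) : V -> U :=
  xget (fun=> 0) [set S | is_pinv dotU dotV T S].

Definition has_dim V (W : set V) (d : nat) : Prop :=
  exists e : 'I_d -> V,
    (forall c : 'I_d -> F, \sum_i c i *: e i = 0 -> forall i, c i = 0) /\
    W = [set \sum_i c i *: e i | c in [set: 'I_d -> F]].

(* Junk value 0 when W is not a finite-dimensional subspace. *)
Definition dim V (W : set V) : nat := xget 0%N [set d | has_dim W d].

End InnerProductOperators.

Section Bochner.
Variables (R : realType) (k : scalar_kind).
Local Notation F := (scalars R k).

Definition dotF n (x y : 'cV[F]_n) : F := \sum_i sconj (x i 0) * y i 0.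

Definition ctr p q (M : 'M[F]_(p, q)) : 'M[F]_(q, p) := map_mx (@sconj R k) M^T.

Variable H : hilbertType R k.

(* Vectors of H^m are finite functions and not matrices of type 'M[H]_(m, 1),
   because a matrix type is an lmodType only over the ring of its entries. *)
Definition dotH m (x y : {ffun 'I_m -> H}) : F := \sum_i inner (x i) (y i).

Definition bapp m n (A : 'M[H]_(m, n)) (x : 'cV[F]_n) : {ffun 'I_m -> H} :=
  [ffun i => \sum_j x j 0 *: A i j].

(* Product of a Bochner matrix and a classical matrix. *)
Definition bmul m n p (A : 'M[H]_(m, n)) (M : 'M[F]_(n, p)) : 'M[H]_(m, p) :=
  \matrix_(i, l) \sum_j M j l *: A i j.

Definition badj m n (A : 'M[H]_(m, n)) (y : {ffun 'I_m -> H}) : 'cV[F]_n :=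
  \col_j \sum_i inner (A i j) (y i).

Definition colwise m n p (T : {ffun 'I_m -> H} -> 'cV[F]_n) (A : 'M[H]_(m, p)) :
    'M[F]_(n, p) :=
  \matrix_(i, l) T [ffun a => A a l] i 0.

Definition brank m n (A : 'M[H]_(m, n)) : nat :=
  dim (range (bapp A)).

Definition bpinv m n (A : 'M[H]_(m, n)) : {ffun 'I_m -> H} -> 'cV[F]_n :=
  pinv (@dotF n) (@dotH m) (bapp A).

Definition cpinv p q (M : 'M[F]_(p, q)) : 'cV[F]_p -> 'cV[F]_q :=
  pinv (@dotF q) (@dotF p) (fun x : 'cV[F]_q => M *m x).

Definition is_svd m n r (A : 'M[H]_(m, n)) (U : 'M[H]_(m, r))
    (s : 'I_r -> R) (V : 'M[F]_(n, r)) : Prop :=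
  [/\ r = brank A,
      colwise (badj U) U = 1%:M,
      ctr V *m V = 1%:M,
      (forall i, 0 < s i) /\ (forall i j : 'I_r, (i <= j)%N -> s j <= s i) &
      A = bmul U (diag_mx (\row_i of_real k (s i)) *m ctr V)].

(* The sequence of singular values, indexed from 0 and padded by zeros; the
   zero matrix has the SVD with r = 0. *)
Definition is_singular_values m n (A : 'M[H]_(m, n)) (s : nat -> R) : Prop :=
  exists (r : nat) (U : 'M[H]_(m, r)) (V : 'M[F]_(n, r)),
    is_svd A U (fun i => s i) V /\ forall j, (r <= j)%N -> s j = 0.

Definition singular_values m n (A : 'M[H]_(m, n)) : nat -> R :=
  xget (fun=> 0) [set s | is_singular_values A s].

End Bochner.

Definition fin_supp (R : realType) (x : nat -> R) : Prop :=
  exists N, forall j, (N <= j)%N -> x j = 0.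

(* Only the values on finitely supported sequences matter. *)
Record sym_gauge (R : realType) := SymGauge {
  gauge :> (nat -> R) -> R ;
  gauge_gt0 : forall x, fin_supp x -> (exists j, x j != 0) -> 0 < gauge x ;
  gaugeZ : forall (a : R) x, fin_supp x ->
    gauge (fun j => a * x j) = `|a| * gauge x ;
  gaugeD : forall x y, fin_supp x -> fin_supp y ->
    gauge (fun j => x j + y j) <= gauge x + gauge y ;
  gauge_perm : forall (p : nat -> nat) x, fin_supp x -> bijective p ->
    gauge (fun j => x (p j)) = gauge x ;
  gauge_sign : forall (e : nat -> bool) x, fin_supp x ->
    gauge (fun j => (-1) ^+ e j * x j) = gauge x ;
  gauge_normalized : gauge (fun j => (j == 0%N)%:R) = 1 }.

Definition gauge_norm (R : realType) (k : scalar_kind) (H : hilbertType R k)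
    (phi : sym_gauge R) m n (A : 'M[H]_(m, n)) : R :=
  phi (singular_values A).

Definition rows T m n (I : {set 'I_m}) (A : 'M[T]_(m, n)) : 'M[T]_(#|I|, n) :=
  rowsub (fun i : 'I_#|I| => enum_val i) A.

Definition cols T m n (J : {set 'I_n}) (A : 'M[T]_(m, n)) : 'M[T]_(m, #|J|) :=
  colsub (fun j : 'I_#|J| => enum_val j) A.

Section Adjoint.
Variables (R : realType) (k : scalar_kind) (H : hilbertType R k).
Local Notation F := (scalars R k).

Lemma sconjD (a b : F) : sconj (a + b) = sconj a + sconj b.
Proof. by case: k a b => // a b; rewrite /= rmorphD. Qed.

Lemma sconjM (a b : F) : sconj (a * b) = sconj a * sconj b.
Proof. by case: k a b => // a b; rewrite /= rmorphM. Qed.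

Lemma sconj0 : sconj (0 : F) = 0.
Proof. by apply: (addrI (sconj 0)); rewrite -sconjD !addr0. Qed.

Lemma sconjK : involutive (@sconj R k).
Proof. by case: k => // a; rewrite /= conjcK. Qed.

Lemma innerDr (x y z : H) : inner x (y + z) = inner x y + inner x z.
Proof. by have := inner_linearr x y z 1; rewrite scale1r mul1r. Qed.

Lemma inner0r (x : H) : inner x 0 = 0.
Proof. by apply: (addrI (inner x 0)); rewrite -innerDr !addr0. Qed.

Lemma innerZr (a : F) (x y : H) : inner x (a *: y) = a * inner x y.
Proof. by have := inner_linearr x y 0 a; rewrite !addr0 inner0r addr0. Qed.

Lemma badjP m n (A : 'M[H]_(m, n)) (x : 'cV[F]_n) (y : {ffun 'I_m -> H}) :
  dotH (bapp A x) y = dotF x (badj A y).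
Proof.
have suml (u : 'I_n -> H) (z : H) :
    inner (\sum_j u j) z = \sum_j inner (u j) z.
  rewrite inner_conj (big_morph (inner z) (innerDr z) (inner0r z)).
  rewrite (big_morph _ sconjD sconj0).
  by apply: eq_bigr => j _; rewrite -inner_conj.
rewrite /dotH /dotF; under eq_bigr do rewrite ffunE suml.
rewrite exchange_big; apply: eq_bigr => j _.
rewrite mxE mulr_sumr; apply: eq_bigr => i _.
by rewrite inner_conj innerZr sconjM -inner_conj.
Qed.

End Adjoint.

(* Main.v *)
(** Write [P = U U(I,:)^+] and [Q = (V(J,:)^* )^+ V^*].  The rank hypothesis makes
    [U(I,:)] injective and [V(J,:)^*] surjective, so [B = P G_B Q], [R_B = G_B Q]
    and [C_B = P G_B].  With [X = C_E - P G_E] and [Y = R_E - G_E Q] one gets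
    [C = P G + X], [R = G Q + Y], hence
      [B - C G^+ R = - P G_E Q - P G G^+ Y - X G^+ G Q - X G^+ Y],
    where [G G^+] and [G^+ G] are contractions.  Every summand has the form
    [T E' M] with [E'] one of [G_E], [R_E], [C_E].  Pairing with the singular
    vectors of the left-hand side bounds its Ky Fan sums by the same combination
    of the Ky Fan sums of [G_E], [R_E], [C_E], and a symmetric gauge function is
    monotone under weak majorization. *)

Require Import Defs.
From HB Require Import structures.
From mathcomp Require Import all_boot all_order all_algebra all_fingroup.
From mathcomp Require Import boolp classical_sets reals topology normedtype.
From mathcomp Require Import complex ring lra.
From mathcomp Require Import spectral sesquilinear.
Set Implicit Arguments.
Unset Strict Implicit.
Unset Printing Implicit Defensive.

Import Order.TTheory GRing.Theory Num.Theory.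
Import numFieldNormedType.Exports.
Local Open Scope ring_scope.

(** * Symmetric gauge functions and weak majorization *)

(** Nothing is assumed about the rank or conditioning of [G], so $G^+$ is not compared with $G_B^+$.
    It enters only through the Penrose equations and its norm, while $P$ and $Q$ are built from the
    exact matrix $B$. The blocks $G_E$, $R_E$, $C_E$ act between different spaces, so bounding the
    four summands takes both a triangle inequality and an ideal property of the norm. Ky Fan sums
    give both at once: pairing with orthonormal families is additive, and the factors $T$, $M$ cost
    only their norms. The constant 3 counts the occurrences of $G_E$ between factors of norms
    $\eta_r$ and $\eta_c$: in $B = P(G - G_E)Q$, inside $Y$ and inside $X$. The products of two
    error norms come from $X G^+ Y$, where $X$ is measured in operator norm, at most $\|C_E\|_\phi +
    \eta_r\|G_E\|_\phi$. Although $\mathrm{H}$ may have infinite dimension, every SVD comes from an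
    $n \times n$ Gram matrix over the scalars. *)

Section Gauge.
Variables (R : realType) (phi : sym_gauge R).
Implicit Types (x y : nat -> R).

Lemma fin_supp_comb {x y} (a b : R) :
  fin_supp x -> fin_supp y -> fin_supp (fun j => a * x j + b * y j).
Proof.
move=> [N xN] [M yM]; exists (maxn N M) => j; rewrite geq_max => /andP[Nj Mj].
by rewrite xN // yM // !mulr0 addr0.
Qed.

Lemma fin_suppZ {x} (a : R) : fin_supp x -> fin_supp (fun j => a * x j).
Proof. by move=> [N xN]; exists N => j Nj; rewrite xN // mulr0. Qed.

Lemma gauge_comb (a b : R) x y : 0 <= a -> 0 <= b -> fin_supp x -> fin_supp y ->
  phi (fun j => a * x j + b * y j) <= a * phi x + b * phi y.
Proof.
move=> a0 b0 xs ys.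
rewrite (le_trans (gaugeD phi (fin_suppZ a xs) (fin_suppZ b ys))) //.
by rewrite !gaugeZ // !ger0_norm.
Qed.

Lemma gauge_ge0 x : fin_supp x -> 0 <= phi x.
Proof.
move=> xs; have [x0|/existsNP[j /eqP xj]] := pselect (forall j, x j = 0).
  have -> : x = (fun j => 0 * x j) by apply/funext => j; rewrite mul0r.
  by rewrite gaugeZ // normr0 mul0r.
by apply/ltW/gauge_gt0 => //; exists j.
Qed.

(** With $t = b/x_j$, the shrunk sequence is the convex combination, with weights $(1+t)/2$ and
    $(1-t)/2$, of [x] and of [x] with the sign of entry [j] flipped; both have the same gauge. *)
Lemma gauge_shrink x (j : nat) (b : R) : fin_supp x -> 0 <= b <= x j ->
  phi (fun i => if i == j then b else x i) <= phi x.
Proof.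
move=> xs /andP[b0 bx]; have [xj0|xj0] := eqVneq (x j) 0.
  rewrite le_eqVlt; apply/orP; left; apply/eqP; congr (phi _).
  by apply/funext => i; case: eqP => // ->; apply/le_anti; rewrite bx xj0 b0.
have xjp : 0 < x j by rewrite lt_neqAle eq_sym xj0 (le_trans b0 bx).
pose t := b / x j.
have t0 : 0 <= t by rewrite divr_ge0 // ltW.
have t1 : t <= 1 by rewrite ler_pdivrMr // mul1r.
have fs : fin_supp (fun i => (-1) ^+ (i == j) * x i).
  by case: xs => N xN; exists N => i Ni; rewrite xN // mulr0.
have -> : (fun i => if i == j then b else x i) =
    (fun i => (1 + t) / 2 * x i + (1 - t) / 2 * ((-1) ^+ (i == j) * x i)).
  apply/funext => i; case: eqP => [->|_]; last by rewrite expr0; field.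
  have -> : b = t * x j by rewrite /t divfK.
  by rewrite expr1; field.
have t0' : 0 <= (1 + t) / 2 by lra.
have t1' : 0 <= (1 - t) / 2 by lra.
rewrite (le_trans (gauge_comb t0' t1' xs fs)) // (gauge_sign phi (pred1 j)) //.
lra.
Qed.

(** Entries are shrunk one at a time; beyond the support of [x] both sequences vanish, so finitely
    many shrinkings suffice. *)
Lemma gauge_mono x y : fin_supp x -> (forall j, 0 <= y j <= x j) ->
  phi y <= phi x.
Proof.
move=> xs yx; have [N xN] := xs.
have fs M : fin_supp (fun i => if (i < M)%N then y i else x i).
  exists N => i Ni; case: ifP => _; last exact: xN.
  by move: (yx i); rewrite xN // => yi; apply/le_anti; rewrite andbC.
suff H L : phi (fun i => if (i < L)%N then y i else x i) <= phi x.
  apply: le_trans (H N); rewrite le_eqVlt; apply/orP; left; apply/eqP.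
  congr (phi _); apply/funext => i; case: ltnP => // Ni.
  by move: (yx i); rewrite xN // => yi; apply/le_anti; rewrite andbC.
elim: L => [|L IH]; first by rewrite le_eqVlt eqxx.
apply: le_trans IH; have /(_ (y L)) := @gauge_shrink _ L _ (fs L).
rewrite ltnn => /(_ (yx L)); congr (phi _ <= _).
apply/funext => i; rewrite ltnS (leq_eqVlt i).
by case: (eqVneq i L) => [->|].
Qed.

(** Moving part of the gap $x_j - x_k$ averages [x] with its copy in which entries [j] and [k] are
    swapped, the copy having weight $d/(x_j - x_k)$; the swap preserves the gauge. *)
Lemma gauge_T_transform x (j k : nat) (d : R) : fin_supp x -> j != k ->
    0 <= d <= x j - x k ->
  phi (fun i => x i - d *+ (i == j) + d *+ (i == k)) <= phi x.
Proof.
move=> xs jk /andP[d0 dx].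
pose p i := if i == j then k else if i == k then j else i.
have pK : involutive p.
  move=> i; rewrite /p; have [->|ij] := eqVneq i j.
    by rewrite eqxx eq_sym (negbTE jk).
  by have [->|ik] := eqVneq i k; rewrite ?eqxx // (negbTE ij) (negbTE ik).
have pxs : fin_supp (fun i => x (p i)).
  case: xs => N xN; exists (maxn N (maxn j k).+1) => i.
  rewrite geq_max gtn_max => /and3P[Ni ji ki]; rewrite /p.
  by rewrite (gtn_eqF ji) (gtn_eqF ki) xN.
have [xjk|xjk] := eqVneq (x j - x k) 0.
  have -> : d = 0 by apply/le_anti; rewrite d0 -xjk dx.
  under [X in phi X]funext do rewrite !mul0rn subr0 addr0.
  exact: lexx.
have xjkp : 0 < x j - x k by rewrite lt_neqAle eq_sym xjk (le_trans d0 dx).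
pose t := d / (x j - x k).
have t0 : 0 <= t by rewrite divr_ge0 // ltW.
have t1 : 0 <= 1 - t by rewrite subr_ge0 ler_pdivrMr // mul1r.
have dE : d = t * (x j - x k) by rewrite /t divfK.
have -> : (fun i => x i - d *+ (i == j) + d *+ (i == k)) =
    (fun i => (1 - t) * x i + t * x (p i)).
  apply/funext => i; rewrite /p; have [->|ij] := eqVneq i j.
    by rewrite (negbTE jk) !mulr0n mulr1n dE; ring.
  have [->|ik] := eqVneq i k; rewrite ?mulr0n ?mulr1n ?dE; ring.
rewrite (le_trans (gauge_comb t1 t0 xs pxs)) // (gauge_perm phi xs).
  lra.
exact: inv_bij.
Qed.

Lemma sum_mulrb_eq (d : R) (l j : nat) :
  \sum_(i < l) d *+ (i == j :> nat) = d *+ (j < l)%N.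
Proof.
have [jl|lj] := ltnP j l.
  rewrite (bigD1 (Ordinal jl)) //= eqxx big1 ?addr0 // => i.
  by rewrite -val_eqE /= => /negbTE ->.
by rewrite big1 // => i _; rewrite (ltn_eqF (leq_trans (ltn_ord i) lj)).
Qed.

(* Weak majorization: as long as [y <= x] fails, a T-transform of [x] keeps all
   hypotheses, does not increase the gauge, and equates one more entry of [x]
   with that of [y]. *)
Lemma gauge_weak_majorization x y : fin_supp x -> fin_supp y ->
    (forall j, 0 <= y j) -> (forall i j, (i <= j)%N -> y j <= y i) ->
    (forall l, \sum_(i < l) y i <= \sum_(i < l) x i) ->
  phi y <= phi x.
Proof.
move=> [N0 xN0] [N1 yN1] y0 ys; pose N := maxn N0 N1.
have yN j : (N <= j)%N -> y j = 0.
  by move=> Nj; apply: yN1; rewrite (leq_trans _ Nj) // leq_maxr.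
have : forall j, (N <= j)%N -> x j = 0.
  by move=> j Nj; apply: xN0; rewrite (leq_trans _ Nj) // leq_maxl.
clear xN0; move: (leqnn #|[pred i : 'I_N | x i != y i]|).
move: {2}#|_| => d; elim: d x => [|d IH] x cnt xN xy.
  suff -> : y = x by [].
  apply/funext => i; have [Ni|iN] := leqP N i; first by rewrite xN ?yN.
  move: cnt; rewrite leqn0 => /eqP/card0_eq/(_ (Ordinal iN)).
  by rewrite inE /= => /negbT; rewrite negbK => /eqP.
have [yx|] := pselect (forall j, y j <= x j).
  by apply: gauge_mono => [|j]; [exists N | rewrite y0 yx].
move=> /existsNP ex1; have {ex1} : exists k, ~~ (y k <= x k).
  by case: ex1 => k /negP; exists k.
(* [k] is the first failure. Before it [y <= x], and the prefix sums of length [k.+1] are ordered,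
   so some earlier entry [j] has strict slack and can give mass to [k]. *)
move=> /ex_minnP[k yk kmin].
have ylt i : (i < k)%N -> y i <= x i.
  by move=> ik; apply: contraLR ik => /kmin; rewrite -leqNgt.
have : exists j, (j < k)%N && (y j < x j).
  apply/not_existsP => nj; have := xy k.+1; apply/negP; rewrite -ltNge.
  rewrite !big_ord_recr /= (_ : \sum_(i < k) x i = \sum_(i < k) y i).
    by rewrite ltrD2l ltNge.
  apply: eq_bigr => i _; apply/le_anti; rewrite ylt // andbT leNgt.
  by apply/negP => h; apply: (nj i); rewrite ltn_ord.
move=> [j0 /andP[j0k yxj0]].
have {j0 j0k yxj0} [j [jk yxj]] : exists j, (j < k)%N /\ y j < x j.
  by exists j0.
rewrite -ltNge in yk.
have xjk : x k < x j.
  by rewrite (lt_trans yk) // (le_lt_trans _ yxj) // ys // ltnW.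
(* The largest transfer that does not overshoot [y] at [j] or at [k]. It makes one of the two
   entries agree with [y], which lowers the count of the induction. *)
pose e := Num.min (x j - y j) (y k - x k).
have e0 : 0 <= e by rewrite le_min; apply/andP; split; lra.
have ej : e <= x j - y j by rewrite /e ge_min lexx.
have ek : e <= y k - x k by rewrite /e ge_min lexx orbT.
have yjk : y k <= y j by rewrite ys // ltnW.
pose x' i := x i - e *+ (i == j) + e *+ (i == k).
have jNk : j != k by rewrite ltn_eqF.
have x'j : x' j = x j - e by rewrite /x' eqxx (negbTE jNk) addr0.
have x'k : x' k = x k + e by rewrite /x' eqxx eq_sym (negbTE jNk) subr0.
have x'E i : i != j -> i != k -> x' i = x i.
  by rewrite /x' => /negbTE -> /negbTE ->; rewrite subr0 addr0.
have kN : (k < N)%N.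
  by rewrite ltnNge; apply: contraTN yk => Nk; rewrite xN ?yN ?ltxx.
have jN := ltn_trans jk kN.
have : phi x' <= phi x.
  apply: gauge_T_transform => //; first by exists N.
  by rewrite e0 /=; lra.
apply: le_trans; apply: IH => [|i Ni|l].
- rewrite -ltnS; apply: leq_trans cnt; apply/proper_card/properP; split.
    apply/fintype.subsetP => i; rewrite !inE; have [ij|ij] := eqVneq (val i) j.
      by move=> _; rewrite ij gt_eqF.
    have [ik|ik] := eqVneq (val i) k; first by move=> _; rewrite ik lt_eqF.
    by rewrite x'E.
  have [E|E] : e = x j - y j \/ e = y k - x k.
  - by rewrite /e; case: leP; [left|right].
  - exists (Ordinal jN); rewrite !inE /=; first by rewrite gt_eqF.
    by rewrite x'j E subKr eqxx.
  - exists (Ordinal kN); rewrite !inE /=; first by rewrite lt_eqF.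
    by rewrite x'k E addrC subrK eqxx.
- by rewrite x'E ?xN // gtn_eqF // (leq_trans _ Ni).
- rewrite /x' big_split sumrB /= !sum_mulrb_eq.
  have [jl|lj] := ltnP j l; last first.
    by rewrite ltnNge (leq_trans lj (ltnW jk)) /= !mulr0n subr0 addr0 xy.
  have [kl|lk] := ltnP k l; first by rewrite mulr1n subrK xy.
  (* Here [j < l <= k], so the prefix of [x] loses [e] and gets nothing back. All its entries
     dominate those of [y], and entry [j] alone has slack at least [e]. *)
  rewrite mulr1n mulr0n addr0 lerBrDr addrC -lerBrDr -sumrB.
  apply: le_trans ej _; rewrite (bigD1 (Ordinal jl)) //= lerDl sumr_ge0 // => i _.
  by rewrite subr_ge0 ylt // (leq_trans _ lk).
Qed.

End Gauge.

(** * Scalars *)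

Lemma conjcE (R : realType) (z : R[i]) : conjc z = Num.conj z.
Proof.
by [].
Qed.

Lemma complex_hermitian_eigenvalue (R : realType) n (M : 'M[R[i]]_n) :
  map_mx conjc M^T = M -> M != 0 ->
  exists2 l : R, l != 0 & eigenvalue M l%:C%C.
Proof.
move=> hM M0.
have herm : M \is hermsymmx.
  apply/is_hermitianmxP; rewrite expr0 scale1r -{1}hM.
  by apply/matrixP => i j; rewrite !mxE conjcE.
have ME := orthomx_spectralP (hermitian_normalmx herm).
set P := spectralmx M in ME; set D := spectral_diag M in ME.
have Pu : P \in unitmx := spectral_unit M.
have [i Di] : exists i, D 0 i != 0.
  apply: contra_notP (negP M0) => nD; rewrite ME (_ : D = 0).
    by rewrite linear0 mulmx0 mul0mx.
  apply/rowP => i; rewrite mxE; apply/eqP/negPn/negP => Di.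
  by apply: nD; exists i.
have /mxOverP/(_ 0 i)/complex_realP[l lE] := hermitian_spectral_diag_real herm.
exists l; first by apply: contraNneq Di => l0; rewrite /D lE l0.
apply/eigenvalueP; exists (row i P).
  rewrite -lE -row_mul {1}ME !mulmxA mulmxV // mul1mx.
  by apply/rowP => j; rewrite !mxE (bigD1 i) //= mxE eqxx mulr1n big1 ?addr0
    // => a ai; rewrite mxE eq_sym (negbTE ai) mulr0n mul0r.
apply: contraTneq isT => Pi0.
have := mulmxV Pu; move/(congr1 (row i)); rewrite row_mul Pi0 mul0mx.
by move/rowP/(_ i)/eqP; rewrite !mxE eqxx eq_sym oner_eq0.
Qed.

Section Scalars.
Variables (R : realType) (k : scalar_kind).
Local Notation F := (scalars R k).
Implicit Types (a b z : F).

(** A real symmetric matrix is treated as a complex Hermitian one. The eigenvalue found is real and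
    a root of the characteristic polynomial, a property that descends to the real field. *)
Lemma hermitian_eigenvalue n (M : 'M[F]_n) : ctr M = M -> M != 0 ->
  exists2 l : R, l != 0 & eigenvalue M (of_real k l).
Proof.
rewrite /ctr; case: k M => M hM M0; last exact: complex_hermitian_eigenvalue.
pose MC := map_mx (real_complex R) M.
have [| |l l0 el] := @complex_hermitian_eigenvalue R n MC.
- apply/matrixP => i j; move/matrixP/(_ i j): hM; rewrite !mxE /= => <-.
  by rewrite oppr0.
- by rewrite map_mx_eq0.
exists l => //; move: el; rewrite !eigenvalue_root_char /MC -map_char_poly.
by rewrite (fmorph_root (real_complex R)).
Qed.

Lemma sconjN a : sconj (- a) = - sconj a.
Proof. by apply: (addrI (sconj a)); rewrite -sconjD !subrr sconj0. Qed.

Lemma sconj_sum I (r : seq I) P (f : I -> F) :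
  sconj (\sum_(i <- r | P i) f i) = \sum_(i <- r | P i) sconj (f i).
Proof. exact: (big_morph _ (@sconjD R k) (@sconj0 R k)). Qed.

Lemma sreD a b : sre (a + b) = sre a + sre b.
Proof. by case: k a b => // -[? ?] [? ?]. Qed.

Lemma sreN a : sre (- a) = - sre a.
Proof. by case: k a => // -[? ?]. Qed.

Lemma sre0 : sre (0 : F) = 0.
Proof. by case: k. Qed.

Lemma sre_sum I (r : seq I) P (f : I -> F) :
  sre (\sum_(i <- r | P i) f i) = \sum_(i <- r | P i) sre (f i).
Proof. exact: (big_morph _ sreD sre0). Qed.

Lemma sre_conj a : sre (sconj a) = sre a.
Proof. by case: k a => // -[? ?]. Qed.

Lemma of_realK (l : R) : sre (of_real k l) = l.
Proof. by case: k. Qed.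

Lemma of_realD (l l' : R) : of_real k (l + l') = of_real k l + of_real k l'.
Proof. by case: k => //; apply: (rmorphD (real_complex R)). Qed.

Lemma of_realM (l l' : R) : of_real k (l * l') = of_real k l * of_real k l'.
Proof. by case: k => //=; apply: (rmorphM (real_complex R)). Qed.

Lemma of_real0 : of_real k 0 = 0 :> F.
Proof. by case: k. Qed.

Lemma of_real1 : of_real k 1 = 1 :> F.
Proof. by case: k. Qed.

Lemma of_real_inj : injective (@of_real R k).
Proof. exact: can_inj of_realK. Qed.

Lemma of_real_eq0 (l : R) : (of_real k l == 0) = (l == 0).
Proof. by rewrite -of_real0 (inj_eq of_real_inj). Qed.

Lemma sconj_of_real (l : R) : sconj (of_real k l) = of_real k l.
Proof. by case: k => //=; rewrite oppr0. Qed.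

Lemma sre_of_realM (l : R) a : sre (of_real k l * a) = l * sre a.
Proof. by case: k a => // -[x y] /=; rewrite mul0r subr0. Qed.

Lemma sconj_fixed a : sconj a = a -> a = of_real k (sre a).
Proof.
case: k a => // -[x y] /= [] /eqP; rewrite eq_sym -subr_eq0 opprK.
by rewrite -mulr2n -mulr_natr mulf_eq0 pnatr_eq0 orbF => /eqP ->.
Qed.

(** The squared modulus as an element of [R], since the norm of [F] takes its values in [F]. *)
Definition nsq a : R := sre (sconj a * a).

Lemma nsqE a : sconj a * a = of_real k (nsq a).
Proof. by apply: sconj_fixed; rewrite sconjM sconjK mulrC. Qed.

Lemma nsq_ge0 a : 0 <= nsq a.
Proof.
rewrite /nsq; case: k a => [x|[x y]] /=; first by rewrite -expr2 sqr_ge0.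
by rewrite mulNr opprK addr_ge0 // -expr2 sqr_ge0.
Qed.

Lemma nsq_conj a : nsq (sconj a) = nsq a.
Proof. by rewrite /nsq sconjK mulrC. Qed.

Lemma nsqM a b : nsq (a * b) = nsq a * nsq b.
Proof.
apply: of_real_inj; rewrite of_realM -!nsqE sconjM; ring.
Qed.

Lemma nsq_of_real (l : R) : nsq (of_real k l) = l ^+ 2.
Proof. by rewrite /nsq sconj_of_real sre_of_realM of_realK. Qed.

Lemma nsq_eq0 a : (nsq a == 0) = (a == 0).
Proof.
apply/eqP/eqP => [n0|->]; last by rewrite /nsq mulr0 sre0.
have /eqP := nsqE a; rewrite n0 of_real0 mulf_eq0 => /orP[/eqP c0|/eqP//].
by rewrite -[a]sconjK c0 sconj0.
Qed.

(** Expand $|d\bar a - cb|^2 \ge 0$. The crossed weights balance the two terms when $|a|$ is of size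
    $c$ and $|b|$ of size $d$. *)
Lemma sre_mul_le a b (c d : R) :
  2 * (c * d) * sre (a * b) <= d ^+ 2 * nsq a + c ^+ 2 * nsq b.
Proof.
have := nsq_ge0 (of_real k d * sconj a - of_real k c * b).
rewrite {1}/nsq sconjD sconjN !sconjM sconjK !sconj_of_real.
rewrite !(mulrDl, mulrDr, mulrN, mulNr) opprK !sreD !sreN.
rewrite (_ : of_real k d * a * (of_real k d * sconj a) =
  of_real k d * (of_real k d * (sconj a * a))); last by ring.
rewrite (_ : of_real k d * a * (of_real k c * b) =
  of_real k d * (of_real k c * (a * b))); last by ring.
rewrite (_ : of_real k c * sconj b * (of_real k d * sconj a) =
  of_real k d * (of_real k c * sconj (a * b))); last by rewrite sconjM; ring.
rewrite (_ : of_real k c * sconj b * (of_real k c * b) =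
  of_real k c * (of_real k c * (sconj b * b))); last by ring.
rewrite !sre_of_realM sre_conj -!/(nsq _); lra.
Qed.

End Scalars.

(** * Inner products and bounded operators *)

Section Dot.
Variables (R : realType) (k : scalar_kind).
Local Notation F := (scalars R k).
Implicit Types U V W : lmodType F.

Record is_dot V (dot : V -> V -> F) : Prop := IsDot {
  dot_linr : forall x y z a, dot x (a *: y + z) = a * dot x y + dot x z ;
  dot_conj : forall x y, dot y x = sconj (dot x y) ;
  dot_ge0 : forall x, 0 <= sre (dot x x) ;
  dot_eq0 : forall x, sre (dot x x) = 0 -> x = 0 }.

Definition lin U V (T : U -> V) : Prop :=
  forall a x y, T (a *: x + y) = a *: T x + T y.

Definition orthonormal_family V (dot : V -> V -> F) r (u : 'I_r -> V) : Prop :=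
  forall i j, dot (u i) (u j) = (i == j)%:R.

(** An explicit bound composes and adds directly, whereas the supremum [op_norm] carries information
    only once its set is known to be bounded. *)
Definition bounded_by U V (dU : U -> U -> F) (dV : V -> V -> F) (c : R)
    (T : U -> V) : Prop :=
  forall x, dot_norm dV (T x) <= c * dot_norm dU x.

Section Lin.
Variables (U V : lmodType F) (T : U -> V) (hT : lin T).

Lemma linD x y : T (x + y) = T x + T y.
Proof. by have := hT 1 x y; rewrite !scale1r. Qed.

Lemma lin0 : T 0 = 0.
Proof. by apply: (addrI (T 0)); rewrite -linD !addr0. Qed.

Lemma linZ a x : T (a *: x) = a *: T x.
Proof. by have := hT a x 0; rewrite lin0 !addr0. Qed.

Lemma linN x : T (- x) = - T x.
Proof. by apply: (addrI (T x)); rewrite -linD !subrr lin0. Qed.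

Lemma linB x y : T (x - y) = T x - T y.
Proof. by rewrite linD linN. Qed.

Lemma lin_sum I (r : seq I) P (f : I -> U) :
  T (\sum_(i <- r | P i) f i) = \sum_(i <- r | P i) T (f i).
Proof. exact: (big_morph _ linD lin0). Qed.

End Lin.

Lemma lin_comp U V W (S : V -> W) (T : U -> V) :
  lin S -> lin T -> lin (fun x => S (T x)).
Proof. by move=> hS hT a x y; rewrite hT hS. Qed.

Section DotTheory.
Variables (V : lmodType F) (dot : V -> V -> F) (hd : is_dot dot).
Implicit Types x y z : V.
Local Notation N := (dot_norm dot).

Lemma dotDr x y z : dot x (y + z) = dot x y + dot x z.
Proof. by have := dot_linr hd x y z 1; rewrite scale1r mul1r. Qed.

Lemma dot0r x : dot x 0 = 0.
Proof. by apply: (addrI (dot x 0)); rewrite -dotDr !addr0. Qed.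

Lemma dotZr x a y : dot x (a *: y) = a * dot x y.
Proof. by have := dot_linr hd x y 0 a; rewrite !addr0 dot0r addr0. Qed.

Lemma dotNr x y : dot x (- y) = - dot x y.
Proof. by rewrite -scaleN1r dotZr mulN1r. Qed.

Lemma dot_sumr I (r : seq I) P (f : I -> V) x :
  dot x (\sum_(i <- r | P i) f i) = \sum_(i <- r | P i) dot x (f i).
Proof. exact: (big_morph _ (dotDr x) (dot0r x)). Qed.

Lemma dotDl x y z : dot (x + y) z = dot x z + dot y z.
Proof. by rewrite dot_conj // dotDr sconjD -!(dot_conj hd). Qed.

Lemma dotZl a x y : dot (a *: x) y = sconj a * dot x y.
Proof. by rewrite dot_conj // dotZr sconjM -(dot_conj hd). Qed.

Lemma dotNl x y : dot (- x) y = - dot x y.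
Proof. by rewrite dot_conj // dotNr sconjN -(dot_conj hd). Qed.

Lemma dot0l x : dot 0 x = 0.
Proof. by rewrite dot_conj // dot0r sconj0. Qed.

Lemma dot_suml I (r : seq I) P (f : I -> V) x :
  dot (\sum_(i <- r | P i) f i) x = \sum_(i <- r | P i) dot (f i) x.
Proof. exact: (big_morph (dot^~ x) (fun y z => dotDl y z x) (dot0l x)). Qed.

Lemma dot_norm_ge0 x : 0 <= N x.
Proof. exact: sqrtr_ge0. Qed.

Lemma dot_norm_sqr x : N x ^+ 2 = sre (dot x x).
Proof. by rewrite sqr_sqrtr // dot_ge0. Qed.

Lemma dot_self x : dot x x = of_real k (N x ^+ 2).
Proof. by rewrite dot_norm_sqr; apply/sconj_fixed; rewrite -dot_conj. Qed.

Lemma dot_norm_eq0 x : N x = 0 -> x = 0.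
Proof. by move=> x0; apply: (dot_eq0 hd); rewrite -dot_norm_sqr x0 expr0n. Qed.

Lemma dot_norm0 : N 0 = 0.
Proof. by rewrite /dot_norm dot0r sre0 sqrtr0. Qed.

Lemma dot_normZ a x : N (a *: x) = Num.sqrt (nsq a) * N x.
Proof.
rewrite -sqrtrM ?nsq_ge0 // /dot_norm dotZr dotZl mulrA [a * _]mulrC nsqE.
by rewrite sre_of_realM.
Qed.

Lemma dot_normN x : N (- x) = N x.
Proof. by rewrite /dot_norm dotNr dotNl opprK. Qed.

Lemma cauchy_schwarz x y : sre (dot x y) <= N x * N y.
Proof.
have [x0|x0] := eqVneq (N x) 0.
  by rewrite (dot_norm_eq0 x0) dot0l sre0 dot_norm0 mul0r.
have [y0|y0] := eqVneq (N y) 0.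
  by rewrite (dot_norm_eq0 y0) dot0r sre0 dot_norm0 mulr0.
have xy0 : 0 < N x * N y.
  by rewrite mulr_gt0 // lt_neqAle eq_sym ?x0 ?y0 dot_norm_ge0.
have := dot_ge0 hd (of_real k (N y) *: x - of_real k (N x) *: y).
rewrite !(dotDl, dotDr, dotNl, dotNr, dotZl, dotZr) (dot_conj hd x y).
rewrite !sconj_of_real !(sreD, sreN, sre_of_realM) sre_conj -!dot_norm_sqr.
move=> h; rewrite -(ler_pM2l xy0); lra.
Qed.

Lemma dot_normD x y : N (x + y) <= N x + N y.
Proof.
rewrite -(@ler_pXn2r _ 2) ?nnegrE ?addr_ge0 ?dot_norm_ge0 //.
rewrite dot_norm_sqr dotDl !dotDr (dot_conj hd x y) !sreD sre_conj.
rewrite -!dot_norm_sqr sqrrD; have := cauchy_schwarz x y; lra.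
Qed.

Section Orthonormal.
Variables (r : nat) (u : 'I_r -> V) (hu : orthonormal_family dot u).

Lemma dot_orthonormal_sum (c : 'I_r -> F) j :
  dot (u j) (\sum_i c i *: u i) = c j.
Proof.
rewrite dot_sumr (bigD1 j) //= dotZr hu eqxx mulr1 big1 ?addr0 // => i ij.
by rewrite dotZr hu eq_sym (negbTE ij) mulr0.
Qed.

Lemma dot_norm_orthonormal_sum (c : 'I_r -> F) :
  N (\sum_i c i *: u i) ^+ 2 = \sum_i nsq (c i).
Proof.
rewrite dot_norm_sqr dot_suml sre_sum; apply: eq_bigr => i _.
by rewrite dotZl dot_orthonormal_sum.
Qed.

Lemma bessel x : \sum_i nsq (dot (u i) x) <= N x ^+ 2.
Proof.
pose p := \sum_i dot (u i) x *: u i.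
have := dot_ge0 hd (x - p).
rewrite !(dotDl, dotDr, dotNl, dotNr) (dot_conj hd p x).
have -> : dot p x = of_real k (\sum_i nsq (dot (u i) x)).
  rewrite dot_suml (big_morph _ (@of_realD R k) (@of_real0 R k)).
  by apply: eq_bigr => i _; rewrite dotZl nsqE.
rewrite sconj_of_real (dot_self p) dot_norm_orthonormal_sum.
rewrite !(sreD, sreN) !of_realK -dot_norm_sqr; lra.
Qed.

Lemma dot_norm_orthonormal i : N (u i) = 1.
Proof. by rewrite /dot_norm hu eqxx -(of_real1 R k) of_realK sqrtr1. Qed.

End Orthonormal.

Lemma dot_norm_sum I (r : seq I) P (f : I -> V) :
  N (\sum_(i <- r | P i) f i) <= \sum_(i <- r | P i) N (f i).
Proof.
elim/big_rec2: _ => [|i y x _ xy]; first by rewrite dot_norm0.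
by rewrite (le_trans (dot_normD _ _)) // lerD2l.
Qed.

(** To pass from real part to modulus, Cauchy--Schwarz is applied to $\langle x,y\rangle x$ and $y$,
    whose inner product is $|\langle x,y\rangle|^2$. *)
Lemma unit_bessel x y : N x <= 1 -> nsq (dot x y) <= N y ^+ 2.
Proof.
move=> x1; pose a := dot x y.
have h : sre (dot (a *: x) y) <= Num.sqrt (nsq a) * N y.
  apply: le_trans (cauchy_schwarz _ _) _.
  rewrite dot_normZ ler_wpM2r ?dot_norm_ge0 // ler_piMr ?sqrtr_ge0 //.
rewrite dotZl -/a -/(nsq a) -{1}(sqr_sqrtr (nsq_ge0 a)) in h.
rewrite -/a -(sqr_sqrtr (nsq_ge0 a)) ler_pXn2r ?nnegrE ?sqrtr_ge0 ?dot_norm_ge0 //.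
have [->|n0] := eqVneq (Num.sqrt (nsq a)) 0; first exact: dot_norm_ge0.
by rewrite expr2 ler_pM2l // lt_neqAle eq_sym n0 sqrtr_ge0 in h.
Qed.

(** The two hypotheses give $\|py\|^2 = \langle y, py\rangle \le \|y\|\,\|py\|$. *)
Lemma projection_contraction (p : V -> V) :
  (forall y z, dot (p y) z = dot y (p z)) -> (forall y, p (p y) = p y) ->
  bounded_by dot dot 1 p.
Proof.
move=> psa pp y; rewrite mul1r.
have [->|n0] := eqVneq (N (p y)) 0; first exact: dot_norm_ge0.
rewrite -(@ler_pM2r _ (N (p y))) ?lt_neqAle ?(eq_sym 0) ?n0 ?dot_norm_ge0 //.
by rewrite -expr2 dot_norm_sqr psa pp cauchy_schwarz.
Qed.

End DotTheory.

Section Bounded.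
Variables (U V W : lmodType F).
Variables (dU : U -> U -> F) (dV : V -> V -> F) (dW : W -> W -> F).
Hypotheses (hU : is_dot dU) (hV : is_dot dV) (hW : is_dot dW).

Lemma bounded_comp (c d : R) (S : V -> W) (T : U -> V) : 0 <= c ->
  bounded_by dV dW c S -> bounded_by dU dV d T ->
  bounded_by dU dW (c * d) (fun x => S (T x)).
Proof.
move=> c0 hS hT x; rewrite (le_trans (hS _)) // -mulrA ler_wpM2l //.
Qed.

Lemma bounded_add (c d : R) (S T : U -> V) :
  bounded_by dU dV c S -> bounded_by dU dV d T ->
  bounded_by dU dV (c + d) (fun x => S x + T x).
Proof.
by move=> hS hT x; rewrite (le_trans (dot_normD hV _ _)) // mulrDl lerD.
Qed.

Lemma bounded_opp (c : R) (T : U -> V) :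
  bounded_by dU dV c T -> bounded_by dU dV c (fun x => - T x).
Proof. by move=> hT x; rewrite (dot_normN hV). Qed.

Lemma bounded0 (T : U -> V) x : bounded_by dU dV 0 T -> T x = 0.
Proof.
move=> /(_ x); rewrite mul0r => h; apply: (dot_norm_eq0 hV).
by apply/le_anti; rewrite h dot_norm_ge0.
Qed.

(** Any bound [c] makes the supremum a genuine one; rescaling to the unit ball then gives the
    estimate. In the proof [c] is replaced by [Num.max c 0], as it may be negative when only $x = 0$
    is available. *)
Lemma op_norm_spec (c : R) (T : U -> V) : lin T -> bounded_by dU dV c T ->
  0 <= op_norm dU dV T /\ bounded_by dU dV (op_norm dU dV T) T.
Proof.
move=> lT hT; pose S :=
  [set dot_norm dV (T x) | x in [set x | dot_norm dU x <= 1]]%classic.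
have inS x : dot_norm dU x <= 1 -> dot_norm dV (T x) <= sup S.
  move=> x1; apply: ub_le_sup; last by exists x.
  exists (Num.max c 0) => _ [y /= y1 <-]; apply: (le_trans (hT y)).
  rewrite (@le_trans _ _ (Num.max c 0 * dot_norm dU y)) //.
    by rewrite ler_wpM2r ?dot_norm_ge0 // le_max lexx.
  by rewrite ler_piMr // le_max lexx orbT.
split.
  apply: le_trans (inS 0 _); first exact: dot_norm_ge0.
  by rewrite (dot_norm0 hU).
move=> x; rewrite -/S.
have [x0|x0] := eqVneq (dot_norm dU x) 0.
  by rewrite x0 mulr0 (dot_norm_eq0 hU x0) (lin0 lT) (dot_norm0 hV).
have xp : 0 < dot_norm dU x by rewrite lt_neqAle eq_sym x0 dot_norm_ge0.
have nE : Num.sqrt (nsq (of_real k (dot_norm dU x)^-1)) = (dot_norm dU x)^-1.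
  by rewrite nsq_of_real sqrtr_sqr ger0_norm // invr_ge0 ltW.
have := inS (of_real k (dot_norm dU x)^-1 *: x).
rewrite (linZ lT) (dot_normZ hU) (dot_normZ hV) nE mulVf // => /(_ (lexx _)).
by rewrite mulrC ler_pdivrMr.
Qed.

End Bounded.
End Dot.

(** * Singular value decomposition *)

Section SVD.
Variables (R : realType) (k : scalar_kind).
Local Notation F := (scalars R k).

Lemma dotFE n (x y : 'cV[F]_n) : dotF x y = (ctr x *m y) 0 0.
Proof. by rewrite mxE; apply: eq_bigr => i _; rewrite !mxE. Qed.

Lemma dotF_is_dot n : is_dot (@dotF R k n).
Proof.
split=> [x y z a|x y|x|x].
- rewrite mulr_sumr -big_split; apply: eq_bigr => i _.
  by rewrite !mxE mulrDr mulrCA.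
- rewrite sconj_sum; apply: eq_bigr => i _.
  by rewrite sconjM sconjK mulrC.
- by rewrite sre_sum sumr_ge0 // => i _; apply: nsq_ge0.
- rewrite sre_sum => /eqP; rewrite psumr_eq0 => [/allP x0|i _]; last exact: nsq_ge0.
  apply/colP => i; rewrite mxE; apply/eqP; rewrite -nsq_eq0.
  exact: x0 (mem_index_enum i).
Qed.

Lemma dotF_delta n (i : 'I_n) (x : 'cV[F]_n) : dotF (delta_mx i 0) x = x i 0.
Proof.
rewrite /dotF (bigD1 i) //= mxE !eqxx -(of_real1 R k) sconj_of_real of_real1.
rewrite mul1r big1 ?addr0 // => j ji.
by rewrite mxE (negbTE ji) sconj0 mul0r.
Qed.

Lemma cV_sum_delta n (x : 'cV[F]_n) : x = \sum_i x i 0 *: delta_mx i 0.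
Proof. by rewrite [LHS]matrix_sum_delta; apply: eq_bigr => i _; rewrite big_ord1. Qed.

Lemma ctrM p q l (A : 'M[F]_(p, q)) (B : 'M[F]_(q, l)) :
  ctr (A *m B) = ctr B *m ctr A.
Proof.
apply/matrixP => i j; rewrite !mxE sconj_sum; apply: eq_bigr => a _.
by rewrite !mxE sconjM mulrC.
Qed.

Lemma ctrK p q (A : 'M[F]_(p, q)) : ctr (ctr A) = A.
Proof. by apply/matrixP => i j; rewrite !mxE sconjK. Qed.

Lemma ctrZ p q a (A : 'M[F]_(p, q)) : ctr (a *: A) = sconj a *: ctr A.
Proof. by apply/matrixP => i j; rewrite !mxE sconjM. Qed.

Lemma nonincreasing_perm r (s : 'I_r -> R) :
  exists p : 'S_r, forall i j : 'I_r, (i <= j)%N -> s (p j) <= s (p i).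
Proof.
pose t := [tuple s i | i < r].
have /tuple_permP[p pE] := permEl (perm_sort (fun a b : R => b <= a) t).
exists p => i j ij.
have tn (a : 'I_r) : s (p a) = nth 0 (sort (fun a b : R => b <= a) t) a.
  by rewrite pE -(tnth_nth 0 [tuple tnth t (p i) | i < r]) !tnth_mktuple.
rewrite !tn; apply: (@sorted_leq_nth _ (fun a b : R => b <= a)) => //.
- by move=> a b c ba ac; apply: le_trans ac ba.
- by apply: sort_sorted => a b; apply: le_total.
- by rewrite inE size_sort size_tuple.
- by rewrite inE size_sort size_tuple.
Qed.

Section Operator.
Variables (V : lmodType F) (dV : V -> V -> F) (hV : is_dot dV) (n : nat).
Implicit Types T : 'cV[F]_n -> V.

Record svd_of T r (u : 'I_r -> V) (s : 'I_r -> R) (v : 'I_r -> 'cV[F]_n) :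
    Prop := SvdOf {
  svd_u : orthonormal_family dV u ;
  svd_v : orthonormal_family (@dotF R k n) v ;
  svd_gt0 : forall i, 0 < s i ;
  svd_sorted : forall i j : 'I_r, (i <= j)%N -> s j <= s i ;
  svd_eq : forall x, T x = \sum_i (of_real k (s i) * dotF (v i) x) *: u i }.

Let hF := dotF_is_dot n.

(* Deflation: if [x] is a unit eigenvector of the Gram matrix [M] of [T] for the
   eigenvalue [l != 0], then [T - T x x^*] has Gram matrix [M - l x x^*], of
   smaller rank. *)
Lemma unsorted_svd d T (M : 'M[F]_n) : lin T ->
    (forall y z, dV (T y) (T z) = dotF y (M *m z)) -> (\rank M <= d)%N ->
  exists r (u : 'I_r -> V) (s : 'I_r -> R) (v : 'I_r -> 'cV[F]_n),
    [/\ orthonormal_family dV u, orthonormal_family (@dotF R k n) v, forall i, 0 < s i &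
      forall x, T x = \sum_i (of_real k (s i) * dotF (v i) x) *: u i].
Proof.
elim: d T M => [|d IH] T M lT hM rk.
  exists 0%N, (fun=> 0), (fun=> 0), (fun=> 0).
  split=> [[]//|[]//|[]//|x]; rewrite big_ord0; apply: (dot_eq0 hV).
  move: rk; rewrite leqn0 mxrank_eq0 => /eqP M0.
  by rewrite hM M0 mul0mx (dot0r hF) sre0.
have [M0|M0] := eqVneq M 0.
  by apply: (IH T M) => //; rewrite M0 mxrank0.
have hermM : ctr M = M.
  have ME i j : M i j = dV (T (delta_mx i 0)) (T (delta_mx j 0)).
    by rewrite hM dotF_delta -colE mxE.
  by apply/matrixP => i j; rewrite !mxE !ME -(dot_conj hV).
have [l l0 /eigenvalueP[w wM w0]] := hermitian_eigenvalue hermM M0.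
pose N := dot_norm (@dotF R k n) (ctr w).
have N0 : N != 0.
  apply: contraNneq w0 => /(dot_norm_eq0 hF) cw0.
  by rewrite -[w]ctrK cw0; apply/eqP/matrixP => i j; rewrite !mxE sconj0.
pose x := of_real k N^-1 *: ctr w.
have xx : dotF x x = 1.
  rewrite (dotZl hF) (dotZr hF) (dot_self hF) sconj_of_real -/N -!of_realM.
  by rewrite (_ : _ * _ = 1) ?of_real1 //; field.
have Mx : M *m x = of_real k l *: x.
  rewrite -scalemxAr -{1}hermM -ctrM wM ctrZ sconj_of_real.
  by rewrite scalerA mulrC -scalerA.
clearbody x.
have TxTx y : dV (T y) (T x) = of_real k l * dotF y x.
  by rewrite hM Mx (dotZr hF).
have lE : l = dot_norm dV (T x) ^+ 2.
  by rewrite (dot_norm_sqr hV) TxTx xx mulr1 of_realK.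
have lp : 0 < l by rewrite lt_neqAle eq_sym l0 lE sqr_ge0.
pose T1 y := T y - dotF x y *: T x.
have lT1 : lin T1.
  move=> a y z; rewrite /T1 lT (dot_linr hF) scalerDl scalerBr scalerA.
  by rewrite opprD addrACA.
pose M1 := M - of_real k l *: (x *m ctr x).
have M1E z : M1 *m z = M *m z - (of_real k l * dotF x z) *: x.
  rewrite mulmxBl -scalemxAl -mulmxA -scalerA; congr (_ - _ *: _).
  by rewrite [ctr x *m z]mx11_scalar -dotFE mul_mx_scalar.
have hM1 y z : dV (T1 y) (T1 z) = dotF y (M1 *m z).
  rewrite M1E !(dotDl hV, dotDr hV, dotNl hV, dotNr hV, dotZl hV, dotZr hV).
  rewrite !(dotDr hF, dotNr hF, dotZr hF) hM !TxTx xx (dot_conj hV (T z)) TxTx.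
  rewrite sconjM sconj_of_real -!(dot_conj hF); ring.
have [//|r [u [s [v [hu hv s0 TE]]]]] := IH T1 M1 lT1 hM1 _.
  rewrite -ltnS; apply: leq_trans rk; apply: rank_ltmx; rewrite ltmxE.
  have M1M : M1 = (1%:M - x *m ctr x) *m M.
    rewrite mulmxBl mul1mx -mulmxA -{2}hermM -ctrM Mx ctrZ sconj_of_real.
    by rewrite -scalemxAr.
  rewrite {1}M1M submxMl; apply/submxP => -[D DE].
  have : M *m x = 0.
    by rewrite DE -mulmxA M1E xx mulr1 Mx subrr mulmx0.
  rewrite Mx => /(congr1 (dotF x)); rewrite (dotZr hF) xx mulr1 (dot0r hF).
  by move/eqP; rewrite of_real_eq0 (negbTE l0).
(* The new singular pair must be orthogonal to the old ones. $T_1$ kills $x$, so $v_i \perp x$; then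
   $T_1 v_i = T v_i$, and $\langle Tv_i, Tx\rangle = l\langle v_i, x\rangle = 0$ gives $u_i \perp
   Tx$. *)
have vx i : dotF (v i) x = 0.
  have : dV (u i) (T1 x) = 0 by rewrite /T1 xx scale1r subrr (dot0r hV).
  rewrite TE (dot_orthonormal_sum hV hu) => /eqP.
  by rewrite mulf_eq0 of_real_eq0 gt_eqF // => /eqP.
have T1v i : T1 (v i) = of_real k (s i) *: u i.
  rewrite TE (bigD1 i) //= hv eqxx mulr1 big1 ?addr0 // => j ji.
  by rewrite hv (negbTE ji) mulr0 scale0r.
have uTx i : dV (u i) (T x) = 0.
  have : dV (T1 (v i)) (T x) = 0.
    rewrite /T1 (dot_conj hF) vx sconj0 scale0r subr0 TxTx vx mulr0 //.
  rewrite T1v (dotZl hV) sconj_of_real => /eqP.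
  by rewrite mulf_eq0 of_real_eq0 gt_eqF // => /eqP.
pose q := Num.sqrt l.
have q0 : 0 < q by rewrite sqrtr_gt0.
have qq : q ^+ 2 = l by rewrite sqr_sqrtr // ltW.
pose u0 := of_real k q^-1 *: T x.
have u0u0 : dV u0 u0 = 1.
  rewrite (dotZl hV) (dotZr hV) TxTx xx mulr1 sconj_of_real -!of_realM -qq.
  by rewrite (_ : _ * _ = 1) ?of_real1 //; field; rewrite gt_eqF.
pose cons C (a : C) (f : 'I_r -> C) (i : 'I_r.+1) := oapp f a (unlift ord0 i).
have cons0 C (a : C) f : cons C a f ord0 = a by rewrite /cons unlift_none.
have consS C (a : C) f i : cons C a f (lift ord0 i) = f i by rewrite /cons liftK.
exists r.+1, (cons _ u0 u), (cons _ q s), (cons _ x v); split.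
- move=> i j; case: (unliftP ord0 i) => [i' ->|->];
    case: (unliftP ord0 j) => [j' ->|->]; rewrite ?cons0 ?consS.
  + by rewrite hu (inj_eq lift_inj).
  + by rewrite (dotZr hV) uTx mulr0.
  + by rewrite (dotZl hV) (dot_conj hV) uTx sconj0 mulr0.
  + by rewrite u0u0.
- move=> i j; case: (unliftP ord0 i) => [i' ->|->];
    case: (unliftP ord0 j) => [j' ->|->]; rewrite ?cons0 ?consS.
  + by rewrite hv (inj_eq lift_inj).
  + by rewrite vx.
  + by rewrite (dot_conj hF) vx sconj0.
  + by rewrite xx.
- by move=> i; case: (unliftP ord0 i) => [i' ->|->]; rewrite ?cons0 ?consS.
- move=> y; rewrite big_ord_recl !cons0; under eq_bigr do rewrite !consS.
  rewrite -TE /T1 /u0 scalerA mulrAC -of_realM mulfV ?gt_eqF //.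
  by rewrite of_real1 mul1r addrC subrK.
Qed.

(** The Gram matrix of the images of the standard basis has size $n$ whatever the dimension of [V],
    so deflation applies; sorting the values comes last. *)
Lemma svd_exists T : lin T -> exists r u s v, @svd_of T r u s v.
Proof.
move=> lT.
pose M := \matrix_(i, j) dV (T (delta_mx i 0)) (T (delta_mx j 0)).
have hM y z : dV (T y) (T z) = dotF y (M *m z).
  rewrite {1}[y]cV_sum_delta {1}[z]cV_sum_delta !(lin_sum lT) (dot_suml hV).
  apply: eq_bigr => i _; rewrite (dot_sumr hV) mxE mulr_sumr.
  apply: eq_bigr => j _; rewrite !(linZ lT) (dotZl hV) (dotZr hV) mxE; ring.
have [r [u [s [v [hu hv s0 TE]]]]] := unsorted_svd lT hM (leqnn _).
have [p ps] := nonincreasing_perm s.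
exists r, (fun i => u (p i)), (fun i => s (p i)), (fun i => v (p i)).
split=> // [i j|i j|x]; rewrite ?hu ?hv ?(inj_eq perm_inj) //.
by rewrite TE (reindex_inj (@perm_inj _ p)).
Qed.

End Operator.
End SVD.

(** * Pseudoinverses and Ky Fan sums *)

Section Pinv.
Variables (R : realType) (k : scalar_kind).
Local Notation F := (scalars R k).

Section Operator.
Variables (V : lmodType F) (dV : V -> V -> F) (hV : is_dot dV) (n : nat).
Local Notation dF := (@dotF R k n).
Let hF := dotF_is_dot R k n : is_dot dF.
Variables (T : 'cV[F]_n -> V) (lT : lin T).

(** The candidate is $v\,\Sigma^{-1}u^*$; with it, $TS$ and $ST$ are the orthogonal projections onto
    the spans of the $u_i$ and of the $v_i$. *)
Lemma svd_pinv r (u : 'I_r -> V) s v : svd_of dV T u s v ->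
  is_pinv dF dV T (fun y => \sum_i (of_real k (s i)^-1 * dV (u i) y) *: v i).
Proof.
case=> hu hv s0 _ TE; set S := fun y => _.
have lS : lin S.
  move=> a y z; rewrite /S scaler_sumr -big_split; apply: eq_bigr => i _.
  by rewrite (dot_linr hV) mulrDr scalerDl scalerA mulrCA.
have ss i : of_real k (s i) * of_real k (s i)^-1 = 1.
  by rewrite -of_realM mulfV ?of_real1 // gt_eqF.
have uT i x : dV (u i) (T x) = of_real k (s i) * dF (v i) x.
  by rewrite TE (dot_orthonormal_sum hV hu).
have ST x : S (T x) = \sum_i dF (v i) x *: v i.
  by apply: eq_bigr => i _; rewrite uT mulrA (mulrC (of_real k _^-1)) ss mul1r.
have TS y : T (S y) = \sum_i dV (u i) y *: u i.
  rewrite TE; apply: eq_bigr => i _.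
  by rewrite (dot_orthonormal_sum hF hv) mulrA ss mul1r.
split=> //.
- by move=> x; rewrite TS TE; apply: eq_bigr => i _;
    rewrite (dot_orthonormal_sum hV hu).
- by move=> y; rewrite {1}/S TS; apply: eq_bigr => i _;
    rewrite (dot_orthonormal_sum hV hu).
- move=> y z; rewrite !TS (dot_suml hV) (dot_sumr hV); apply: eq_bigr => i _.
  by rewrite (dotZl hV) (dotZr hV) -(dot_conj hV) mulrC.
- move=> y z; rewrite !ST (dot_suml hF) (dot_sumr hF); apply: eq_bigr => i _.
  by rewrite (dotZl hF) (dotZr hF) -(dot_conj hF) mulrC.
Qed.

(** The constant is crude on purpose: it serves only to show that the supremum defining the operator
    norm is finite. *)
Lemma svd_pinv_bounded r (u : 'I_r -> V) s v : svd_of dV T u s v ->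
  bounded_by dV dF (\sum_i (s i)^-1)
    (fun y => \sum_i (of_real k (s i)^-1 * dV (u i) y) *: v i).
Proof.
case=> hu hv s0 _ _ y; rewrite (le_trans (dot_norm_sum hF _ _ _)) // mulr_suml.
apply: ler_sum => i _.
rewrite (dot_normZ hF) (dot_norm_orthonormal hv) mulr1.
have si : 0 <= (s i)^-1 by rewrite invr_ge0 ltW.
rewrite -[leRHS]ger0_norm ?mulr_ge0 ?dot_norm_ge0 // -sqrtr_sqr ler_sqrt ?sqr_ge0 //.
rewrite nsqM nsq_of_real exprMn ler_wpM2l ?sqr_ge0 // (unit_bessel hV) //.
by rewrite (dot_norm_orthonormal hu).
Qed.

Lemma is_pinvP : is_pinv dF dV T (pinv dF dV T).
Proof.
have [r [u [s [v hs]]]] := svd_exists hV lT.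
by rewrite /pinv; case: xgetP => [S _ //|/(_ _ (svd_pinv hs))].
Qed.

Lemma pinv_range_contraction S : is_pinv dF dV T S ->
  bounded_by dV dV 1 (fun y => T (S y)).
Proof. by case=> _ _ STS TS _; apply: projection_contraction => // y; rewrite STS. Qed.

Lemma pinv_corange_contraction S : is_pinv dF dV T S ->
  bounded_by dF dF 1 (fun x => S (T x)).
Proof. by case=> _ TST _ _ ST; apply: projection_contraction => // y; rewrite TST. Qed.

(** With $S_0$ the pseudoinverse read off an SVD, $S = STS = (ST)S_0(TS)$, where the outer factors
    are contractions. *)
Lemma pinv_bounded S : is_pinv dF dV T S -> exists c, bounded_by dV dF c S.
Proof.
move=> hS; have [r [u [s [v hs]]]] := svd_exists hV lT.
have S0b := svd_pinv_bounded hs; have [_ TS0T _ _ _] := svd_pinv hs.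
set c := \sum_i _ in S0b; set S0 := fun y => _ in S0b TS0T.
have [_ _ STS _ _] := hS.
have c0 : 0 <= c by apply: sumr_ge0 => i _; rewrite invr_ge0 ltW ?(svd_gt0 hs).
exists (1 * (c * 1)) => y.
rewrite -{1}STS -(TS0T (S y)).
have b1 := bounded_comp c0 S0b (pinv_range_contraction hS).
exact: (bounded_comp ler01 (pinv_corange_contraction hS) b1).
Qed.

Lemma op_norm_pinv : let S := pinv dF dV T in
  0 <= op_norm dV dF S /\ bounded_by dV dF (op_norm dV dF S) S.
Proof.
move=> S; have hS := is_pinvP; have [c hc] := pinv_bounded hS.
by apply: (op_norm_spec hV hF _ hc); case: hS.
Qed.

End Operator.
End Pinv.

(* Abel summation for a nonincreasing [s]: weights in [[0, b]] of total mass at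
   most [l * b] give the most when all the mass sits on the first [l] entries. *)
Lemma sum_nonincreasing_weights (R : realType) (s w : nat -> R) (b : R) r l :
    (forall i, 0 <= s i) -> (forall i j, (i <= j)%N -> s j <= s i) ->
    (forall j, (r <= j)%N -> s j = 0) -> (forall i, 0 <= w i <= b) ->
    \sum_(i < r) w i <= b *+ l ->
  \sum_(i < r) s i * w i <= b * \sum_(i < l) s i.
Proof.
move=> s0 smon sr wb wl.
(* After subtracting the threshold [s l] the comparison holds index by index: the factor is
   nonnegative before [l] and nonpositive after it. The total mass matters only for the part
   [s l * \sum w] put back below. *)
have h : \sum_(i < r) (s i - s l) * w i <= \sum_(i < l) b * (s i - s l).
  have [lr|rl] := leqP l r.
    rewrite (big_ord_widen r (fun i => b * (s i - s l))) //.
    rewrite [leRHS]big_mkcond; apply: ler_sum => i _.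
    have /andP[w0 wlb] := wb i; case: ltnP => il.
      by rewrite mulrC ler_wpM2r // subr_ge0 smon // ltnW.
    by rewrite mulr_le0_ge0 // subr_le0 smon.
  rewrite (big_ord_widen l (fun i => (s i - s l) * w i) (ltnW rl)).
  rewrite [leLHS]big_mkcond; apply: ler_sum => i _.
  have /andP[w0 wlb] := wb i; have sil : 0 <= s i - s l.
    by rewrite subr_ge0 smon // ltnW.
  by case: ifP => _; [rewrite mulrC ler_wpM2r | rewrite mulr_ge0 // (le_trans w0)].
have -> : \sum_(i < r) s i * w i =
    \sum_(i < r) (s i - s l) * w i + s l * \sum_(i < r) w i.
  by rewrite mulr_sumr -big_split; apply: eq_bigr => i _ /=; ring.
rewrite (le_trans (lerD h (ler_wpM2l (s0 l) wl))) //.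
rewrite -mulr_sumr sumrB sumr_const card_ord.
by rewrite le_eqVlt; apply/orP; left; apply/eqP; ring.
Qed.

(** * Ky Fan's inequality for an operator between two bounded factors *)

Section KyFan.
Variables (R : realType) (k : scalar_kind).
Local Notation F := (scalars R k).

(** This is Bessel's inequality for $T^*g$, proved without an adjoint: the vector $x$ with
    coefficients $\overline{\langle g, Tu_i\rangle}$ satisfies $\|x\|^2 = S = \langle g, Tx\rangle$,
    so $S^2 \le \|Tx\|^2 \le c^2 S$. *)
Lemma bessel_bounded (U V : lmodType F) (dU : U -> U -> F) (dV : V -> V -> F)
    (hU : is_dot dU) (hV : is_dot dV) c (T : U -> V) r (u : 'I_r -> U) g :
  lin T -> bounded_by dU dV c T -> orthonormal_family dU u -> dot_norm dV g = 1 ->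
  \sum_i nsq (dV g (T (u i))) <= c ^+ 2.
Proof.
move=> lT bT hu g1; set S := \sum_i _.
pose x := \sum_i sconj (dV g (T (u i))) *: u i.
have xS : dot_norm dU x ^+ 2 = S.
  by rewrite (dot_norm_orthonormal_sum hU hu); apply: eq_bigr => i _; rewrite nsq_conj.
have gTx : dV g (T x) = of_real k S.
  rewrite (lin_sum lT) (dot_sumr hV) (big_morph _ (@of_realD R k) (@of_real0 R k)).
  by apply: eq_bigr => i _; rewrite (linZ lT) (dotZr hV) nsqE.
have S0 : 0 <= S by apply: sumr_ge0 => i _; apply: nsq_ge0.
have [->|Sn0] := eqVneq S 0; first exact: sqr_ge0.
have Sp : 0 < S by rewrite lt_neqAle eq_sym Sn0.
rewrite -(ler_pM2r Sp) -expr2 -(nsq_of_real k S) -gTx.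
rewrite (le_trans (unit_bessel hV _ _)) ?g1 // -xS -exprMn.
rewrite ler_pXn2r ?nnegrE ?dot_norm_ge0 // (le_trans _ (bT x)) ?dot_norm_ge0 //.
Qed.

Variables (U K X : lmodType F).
Variables (dU : U -> U -> F) (dK : K -> K -> F) (dX : X -> X -> F).
Hypotheses (hU : is_dot dU) (hK : is_dot dK) (hX : is_dot dX).

(** Inserting the SVD of [A] turns the left side into $\sum_i s_i \sum_j \mathrm{Re}(a_{ji}b_{ij})$,
    which [sre_mul_le] bounds by $\sum_i s_i w_i$. Bessel over $j$ gives $w_i \le cd$, Bessel over
    $i$ gives total mass at most $l\,cd$, and Abel summation concludes. *)
Lemma ky_fan n (A : 'cV[F]_n -> U) r (u : 'I_r -> U) (s : nat -> R) v
    (T : U -> K) (M : X -> 'cV[F]_n) (c d : R) l (g : 'I_l -> K) (f : 'I_l -> X) :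
    svd_of dU A u (fun i => s i) v -> (forall j, (r <= j)%N -> s j = 0) ->
    lin T -> lin M -> 0 <= c -> 0 <= d ->
    bounded_by dU dK c T -> bounded_by dX (@dotF R k n) d M ->
    orthonormal_family dK g -> orthonormal_family dX f ->
  \sum_j sre (dK (g j) (T (A (M (f j))))) <= c * d * \sum_(i < l) s i.
Proof.
move=> hs sr lT lM; have hF := dotF_is_dot R k n : is_dot (@dotF R k n).
have [hu hv s0 smon AE] := hs.
have A0 : A 0 = 0.
  by rewrite AE big1 // => i _; rewrite (dot0r hF) mulr0 scale0r.
(* The weights below divide by $2cd$, so a vanishing constant is treated apart: the operator is then
   zero. *)
rewrite le_eqVlt => /orP[/eqP <- _ T0 _ _ _|cp].
  rewrite !mul0r big1 // => j _.
  by rewrite (bounded0 hK _ T0) (dot0r hK) sre0.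
rewrite le_eqVlt => /orP[/eqP <- _ M0 _ _|dp bT bM hg hf].
  rewrite mulr0 mul0r big1 // => j _.
  by rewrite (bounded0 hF _ M0) A0 (lin0 lT) (dot0r hK) sre0.
pose a j i := dK (g j) (T (u i)).
pose b i j := dotF (v i) (M (f j)).
pose W (i : 'I_r) := \sum_j (d ^+ 2 * nsq (a j i) + c ^+ 2 * nsq (b i j)) / (2 * (c * d)).
pose w i := if insub i is Some i' then W i' else 0.
have wE (i : 'I_r) : w i = W i by rewrite /w valK.
have cdp : 0 < 2 * (c * d) by rewrite mulr_gt0 // mulr_gt0.
have half x : x <= 2 * (c ^+ 2 * d ^+ 2) -> x / (2 * (c * d)) <= c * d.
  move=> hx; rewrite ler_pdivrMr // (le_trans hx) //.
  by rewrite le_eqVlt; apply/orP; left; apply/eqP; ring.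
have c2 : 0 <= c ^+ 2 by rewrite sqr_ge0.
have d2 : 0 <= d ^+ 2 by rewrite sqr_ge0.
have sqle e (Y Z : lmodType F) (dY : Y -> Y -> F) (dZ : Z -> Z -> F) (Q : Y -> Z) y :
    0 < e -> bounded_by dY dZ e Q -> dot_norm dY y = 1 ->
    dot_norm dZ (Q y) ^+ 2 <= e ^+ 2.
  move=> e0 bQ y1; rewrite ler_pXn2r ?nnegrE ?dot_norm_ge0 ?(ltW e0) //.
  by rewrite (le_trans (bQ y)) // y1 mulr1.
apply: (@le_trans _ _ (\sum_(i < r) s i * w i)).
  under [leRHS]eq_bigr => i _ do rewrite wE /W mulr_sumr.
  rewrite exchange_big; apply: ler_sum => j _.
  rewrite AE (lin_sum lT) (dot_sumr hK) sre_sum; apply: ler_sum => i _.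
  rewrite (linZ lT) (dotZr hK) -mulrA sre_of_realM ler_wpM2l ?(ltW (s0 _)) //.
  by rewrite ler_pdivlMr // mulrC [dotF _ _ * _]mulrC sre_mul_le.
apply: (@sum_nonincreasing_weights R s w (c * d) r l) => //.
- move=> i; have [ir|/sr -> //] := ltnP i r.
  exact: ltW (s0 (Ordinal ir)).
- move=> i j ij; have [jr|rj] := ltnP j r.
    exact: (smon (Ordinal (leq_ltn_trans ij jr)) (Ordinal jr)).
  rewrite (sr j rj); have [ir|/sr -> //] := ltnP i r.
  exact: ltW (s0 (Ordinal ir)).
- move=> i; rewrite /w; case: insubP => [i' _ _|_]; last by rewrite lexx mulr_ge0 // ltW.
  rewrite sumr_ge0 => [|j _] /=; last first.
    by rewrite divr_ge0 ?addr_ge0 ?mulr_ge0 ?nsq_ge0 // ltW.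
  rewrite /W -mulr_suml half // big_split -!mulr_sumr mulr_natl mulr2n /=.
  apply: lerD.
    rewrite mulrC ler_wpM2r //.
    rewrite (le_trans (bessel hK hg _)) // (sqle _ _ _ _ _ _ _ cp bT) //.
    exact: (dot_norm_orthonormal hu).
  rewrite ler_wpM2l //; apply: (bessel_bounded hX hF lM bM hf).
  exact: (dot_norm_orthonormal hv).
- under eq_bigr => i _ do rewrite wE /W.
  rewrite exchange_big (_ : _ *+ l = \sum_(j < l) c * d); last first.
    by rewrite sumr_const card_ord.
  apply: ler_sum => j _; rewrite -mulr_suml half //
    big_split -!mulr_sumr mulr_natl mulr2n /=.
  apply: lerD.
    rewrite mulrC ler_wpM2r //; apply: (bessel_bounded hU hK lT bT hu).
    exact: (dot_norm_orthonormal hg).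
  rewrite ler_wpM2l // (le_trans (bessel hF hv _)) // (sqle _ _ _ _ _ _ _ dp bM) //.
  exact: (dot_norm_orthonormal hf).
Qed.

End KyFan.

(** * Bochner matrices *)

Section Dimension.
Variables (R : realType) (k : scalar_kind).
Local Notation F := (scalars R k).

Lemma row_free_of_kernel p q (M : 'M[F]_(p, q)) :
  (forall c : 'rV_p, c *m M = 0 -> c = 0) -> row_free M.
Proof.
move=> inj; rewrite -kermx_eq0; apply/eqP/row_matrixP => i; rewrite row0.
by apply: inj; rewrite -row_mul mulmx_ker row0.
Qed.

Lemma has_dim_le (V : lmodType F) (W : set V) d d' :
  has_dim W d -> has_dim W d' -> (d <= d')%N.
Proof.
move=> [e [e_free We]] [e' [_ We']].
have /choice[M eM] : forall i, exists c : 'I_d' -> F, e i = \sum_j c j *: e' j.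
  move=> i; have : W (e i).
    rewrite We; exists (fun j => (j == i)%:R) => //.
    rewrite (bigD1 i) //= eqxx scale1r big1 ?addr0 // => j /negbTE ->.
    by rewrite scale0r.
  by rewrite We' => -[c _ <-]; exists c.
have : row_free (\matrix_(i, j) M i j).
  apply: row_free_of_kernel => c cM; apply/rowP => i; rewrite mxE.
  apply: (e_free (fun i => c 0 i)); under eq_bigr do rewrite eM scaler_sumr.
  rewrite exchange_big big1 // => j _; under eq_bigr do rewrite scalerA.
  rewrite -scaler_suml; move/rowP/(_ j): cM; rewrite !mxE.
  by under eq_bigr do rewrite mxE; move=> ->; rewrite scale0r.
by move=> /eqP <-; apply: rank_leq_col.
Qed.

Lemma has_dimE (V : lmodType F) (W : set V) d : has_dim W d -> Defs.dim W = d.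
Proof.
move=> hd; rewrite /Defs.dim; case: xgetP => [d' _ hd'|/(_ _ hd)//].
by apply/eqP; rewrite eqn_leq (has_dim_le hd hd') (has_dim_le hd' hd).
Qed.

End Dimension.

Section Bochner.
Variables (R : realType) (k : scalar_kind) (H : hilbertType R k).
Local Notation F := (scalars R k).

Lemma dotH_is_dot m : is_dot (@dotH R k H m).
Proof.
(* The norm of [H] is [F]-valued, so positivity must be carried to the real part; conjugate symmetry
   shows that its square is real. *)
have nH (x : H) : (0 <= sre (inner x x)) * (sre (inner x x) = 0 -> x = 0).
  rewrite inner_norm.
  have : 0 <= `|x| ^+ 2 by rewrite exprn_ge0.
  have : `|x| ^+ 2 = of_real k (sre (`|x| ^+ 2)).
    by apply: sconj_fixed; rewrite -inner_norm -inner_conj.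
  move=> xE x0; split; last first.
    move=> x2; apply/eqP; rewrite -normr_eq0 -sqrf_eq0 xE x2.
    by rewrite of_real_eq0.
  move: x0; move: (`|x| ^+ 2) => z; case: (k) z => //= z.
  by rewrite lecE => /andP[].
split=> [x y z a|x y|x|x].
- rewrite mulr_sumr -big_split; apply: eq_bigr => i _.
  by rewrite !ffunE inner_linearr.
- by rewrite sconj_sum; apply: eq_bigr => i _; rewrite inner_conj.
- by rewrite sre_sum sumr_ge0 // => i _; exact: (nH _).1.
- rewrite sre_sum => /eqP; rewrite psumr_eq0 => [/allP x0|i _]; last by exact: (nH _).1.
  apply/ffunP => i; rewrite ffunE; apply: (nH _).2; apply/eqP.
  exact: x0 (mem_index_enum i).
Qed.

Section Matrix.
Variables (m n : nat).
Implicit Types A : 'M[H]_(m, n).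

Lemma bapp_lin A : lin (bapp A).
Proof.
move=> a x y; apply/ffunP => i; rewrite !ffunE scaler_sumr -big_split.
by apply: eq_bigr => j _; rewrite !mxE scalerDl scalerA.
Qed.

Lemma bappD A A' x : bapp (A + A') x = bapp A x + bapp A' x.
Proof.
apply/ffunP => i; rewrite !ffunE -big_split; apply: eq_bigr => j _.
by rewrite mxE scalerDr.
Qed.

Lemma bappN A x : bapp (- A) x = - bapp A x.
Proof.
apply/ffunP => i; rewrite !ffunE -sumrN; apply: eq_bigr => j _.
by rewrite mxE scalerN.
Qed.

Lemma bapp_inj A A' : bapp A =1 bapp A' -> A = A'.
Proof.
move=> AA'; apply/matrixP => i j.
have E (C : 'M[H]_(m, n)) : bapp C (delta_mx j 0) i = C i j.
  rewrite ffunE (bigD1 j) //= mxE !eqxx scale1r big1 ?addr0 // => l lj.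
  by rewrite mxE (negbTE lj) scale0r.
by rewrite -!E AA'.
Qed.

Lemma bapp_bmul p A (M : 'M[F]_(n, p)) x : bapp (bmul A M) x = bapp A (M *m x).
Proof.
apply/ffunP => i; rewrite !ffunE; under eq_bigr do rewrite mxE scaler_sumr.
rewrite exchange_big; apply: eq_bigr => j _; rewrite mxE scaler_suml.
by apply: eq_bigr => l _; rewrite scalerA mulrC.
Qed.

Lemma colwise_bapp p (S : {ffun 'I_m -> H} -> 'cV[F]_p) A x :
  lin S -> colwise S A *m x = S (bapp A x).
Proof.
move=> lS; have -> : bapp A x = \sum_j x j 0 *: [ffun a => A a j].
  apply/ffunP => i; rewrite ffunE sum_ffunE.
  by apply: eq_bigr => j _; rewrite !ffunE.
apply/colP => i; rewrite (lin_sum lS) mxE summxE; apply: eq_bigr => j _.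
by rewrite (linZ lS) !mxE mulrC.
Qed.

Lemma bapp_cols r (A : 'M[H]_(m, r)) z :
  bapp A z = \sum_i z i 0 *: [ffun a => A a i].
Proof.
apply/ffunP => a; rewrite ffunE sum_ffunE; apply: eq_bigr => i _.
by rewrite !ffunE.
Qed.

End Matrix.

(** * Singular values of Bochner matrices and their gauge norms *)

Section SingularValues.
Variables (m n : nat).
Implicit Types A : 'M[H]_(m, n).

Lemma svd_of_is_svd A r (U : 'M[H]_(m, r)) s V : is_svd A U s V ->
  svd_of (@dotH R k H m) (bapp A) (fun i => [ffun a => U a i]) s
    (fun i => col i V).
Proof.
move=> [_ UU VV [s0 smon] AE]; split=> //.
- move=> i j; move/matrixP/(_ i j): UU; rewrite !mxE => <-.
  by apply: eq_bigr => a _; rewrite !ffunE.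
- move=> i j; move/matrixP/(_ i j): VV; rewrite !mxE => <-.
  by apply: eq_bigr => a _; rewrite !mxE.
- move=> x; rewrite {1}AE bapp_bmul bapp_cols; apply: eq_bigr => i _.
  congr (_ *: _); rewrite -mulmxA mul_diag_mx !mxE; congr (_ * _).
  by apply: eq_bigr => a _; rewrite !mxE.
Qed.

Lemma svd_of_dim A r (u : 'I_r -> {ffun 'I_m -> H}) s v :
  svd_of (@dotH R k H m) (bapp A) u s v -> brank A = r.
Proof.
move=> [hu hv s0 _ AE]; apply: has_dimE; exists u.
have hH := dotH_is_dot m; have hF := dotF_is_dot R k n; split=> [c c0 i|].
  by rewrite -(dot_orthonormal_sum hH hu c) c0 (dot0r hH).
apply/seteqP; split=> [_ [x _ <-]|_ [c _ <-]] /=.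
  by exists (fun i => of_real k (s i) * dotF (v i) x); rewrite ?AE.
exists (\sum_i (of_real k (s i)^-1 * c i) *: v i) => //; rewrite AE.
apply: eq_bigr => i _; rewrite (dot_orthonormal_sum hF hv) mulrA -of_realM.
by rewrite mulfV ?gt_eqF // of_real1 mul1r.
Qed.

Lemma singular_values_svd A : exists r (u : 'I_r -> {ffun 'I_m -> H}) v,
  svd_of (@dotH R k H m) (bapp A) u (fun i : 'I_r => singular_values A i) v /\
  forall j, (r <= j)%N -> singular_values A j = 0.
Proof.
have hF := dotF_is_dot R k n.
suff : is_singular_values A (singular_values A).
  by move=> [r [U [V [/svd_of_is_svd ? ?]]]]; exists r; do 2 eexists; split; eauto.
suff [s hs] : exists s, is_singular_values A s.
  by rewrite /singular_values; case: xgetP => [//|/(_ _ hs)].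
have [r [u [s [v hs]]]] := svd_exists (dotH_is_dot m) (bapp_lin A).
have [hu hv s0 smon AE] := hs.
pose s' i := if insub i is Some i' then s i' else 0.
have s'E : (fun i : 'I_r => s' i) = s by apply/funext => i; rewrite /s' valK.
pose U : 'M[H]_(m, r) := \matrix_(a, i) u i a.
pose V : 'M[F]_(n, r) := \matrix_(a, i) v i a 0.
have UE i : [ffun a => U a i] = u i by apply/ffunP => a; rewrite ffunE mxE.
exists s', r, U, V; rewrite s'E; split; last first.
  by move=> j rj; rewrite /s' insubN // -leqNgt.
split=> //; first by rewrite (svd_of_dim hs).
- apply/matrixP => i j; rewrite !mxE -hu; apply: eq_bigr => a _.
  by rewrite ffunE !mxE.
- apply/matrixP => i j; rewrite !mxE -hv; apply: eq_bigr => a _.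
  by rewrite !mxE.
- apply: bapp_inj => x; rewrite bapp_bmul AE bapp_cols; apply: eq_bigr => i _.
  rewrite UE; congr (_ *: _); rewrite -mulmxA mul_diag_mx !mxE; congr (_ * _).
  by apply: eq_bigr => a _; rewrite !mxE.
Qed.

Variable phi : sym_gauge R.

Lemma singular_values_fin_supp A : fin_supp (singular_values A).
Proof. by have [r [_ [_ [_ ?]]]] := singular_values_svd A; exists r. Qed.

Lemma singular_values_ge0 A j : 0 <= singular_values A j.
Proof.
have [r [u [v [hs sr]]]] := singular_values_svd A.
have [jr|/sr -> //] := ltnP j r.
exact: ltW (svd_gt0 hs (Ordinal jr)).
Qed.

Lemma singular_values_nonincreasing A i j :
  (i <= j)%N -> singular_values A j <= singular_values A i.
Proof.
have [r [u [v [hs sr]]]] := singular_values_svd A.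
move=> ij; have [jr|/sr -> ] := ltnP j r; last exact: singular_values_ge0.
exact: (svd_sorted hs (i := Ordinal (leq_ltn_trans ij jr)) (j := Ordinal jr)).
Qed.

Lemma gauge_norm_ge0 A : 0 <= gauge_norm phi A.
Proof. exact/gauge_ge0/singular_values_fin_supp. Qed.

(** Comparison with $(\sigma_1, 0, 0, \ldots)$, by normalization and monotonicity, gives $\sigma_1
    \le \|A\|_\phi$. This converts operator norms of error blocks into gauge norms. *)
Lemma gauge_norm_bounded A :
  bounded_by (@dotF R k n) (@dotH R k H m) (gauge_norm phi A) (bapp A).
Proof.
move=> x; have [r [u [v [hs sr]]]] := singular_values_svd A.
set s := singular_values A in hs sr *.
have hF := dotF_is_dot R k n; have hH := dotH_is_dot m.
have s0phi : s 0%N <= gauge_norm phi A.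
  have fs1 : fin_supp (fun j : nat => (j == 0%N)%:R : R) by exists 1%N; case.
  rewrite -[s 0%N]mulr1 -(gauge_normalized phi).
  rewrite -[X in X * _](ger0_norm (singular_values_ge0 A 0%N)) -gaugeZ //.
  apply: gauge_mono; first exact: singular_values_fin_supp.
  case=> [|j]; first by rewrite mulr1 singular_values_ge0 lexx.
  by rewrite mulr0 lexx singular_values_ge0.
apply: (@le_trans _ _ (s 0%N * dot_norm (@dotF R k n) x)); last first.
  by rewrite ler_wpM2r ?dot_norm_ge0.
have [hu hv s0 _ AE] := hs.
rewrite -(@ler_pXn2r _ 2) ?nnegrE ?mulr_ge0 ?dot_norm_ge0 ?singular_values_ge0 //.
rewrite AE (dot_norm_orthonormal_sum hH hu) exprMn.
apply: (@le_trans _ _ (s 0%N ^+ 2 * \sum_i nsq (dotF (v i) x))); last first.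
  by rewrite ler_wpM2l ?sqr_ge0 // (bessel hF hv).
rewrite mulr_sumr; apply: ler_sum => i _.
rewrite nsqM nsq_of_real ler_wpM2r ?nsq_ge0 //.
rewrite ler_pXn2r ?nnegrE ?singular_values_ge0 //.
exact: singular_values_nonincreasing.
Qed.

(** Taking the leading singular vectors for [g] and [f] makes the pairing equal to a Ky Fan sum of
    [A], so weak majorization applies. The pairing is additive in [A], which replaces a triangle
    inequality. *)
Lemma gauge_norm_dominated A (x : nat -> R) : fin_supp x ->
    (forall i, 0 <= x i) ->
    (forall l (g : 'I_l -> {ffun 'I_m -> H}) (f : 'I_l -> 'cV[F]_n),
      orthonormal_family (@dotH R k H m) g ->
      orthonormal_family (@dotF R k n) f ->
      \sum_j sre (dotH (g j) (bapp A (f j))) <= \sum_(i < l) x i) ->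
  gauge_norm phi A <= phi x.
Proof.
move=> xs x0 xA; apply: gauge_weak_majorization => //.
- exact: singular_values_fin_supp.
- exact: singular_values_ge0.
- exact: singular_values_nonincreasing.
move=> l; have [r [u [v [hs sr]]]] := singular_values_svd A.
have [hu hv s0 _ AE] := hs.
(* There are only [r] singular vectors. Past them the singular values vanish, while the remaining
   entries of [x] are nonnegative. *)
pose q := minn l r.
have ql : (q <= l)%N by apply: geq_minl.
have qr : (q <= r)%N by apply: geq_minr.
have E (y : nat -> R) : (forall i, (q <= i < l)%N -> 0 <= y i) ->
    \sum_(i < q) y i <= \sum_(i < l) y i.
  move=> y0; rewrite (big_ord_widen l y ql) big_mkcond; apply: ler_sum => i _.
  by case: ltnP => // qi; rewrite y0 // qi ltn_ord.
apply: (@le_trans _ _ (\sum_(i < q) singular_values A i)).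
  rewrite (big_ord_widen l _ ql) [leRHS]big_mkcond; apply: ler_sum => i _.
  case: ltnP => // qi; rewrite sr //; move: qi; rewrite geq_min => /orP[|//].
  by rewrite leqNgt ltn_ord.
apply: le_trans (E x _) => [|//].
apply: le_trans (xA q (fun i => u (widen_ord qr i)) (fun i => v (widen_ord qr i)) _ _).
- apply: ler_sum => i _; rewrite AE (dot_orthonormal_sum (dotH_is_dot m) hu).
  by rewrite hv eqxx mulr1 of_realK.
- by move=> i j; rewrite hu.
- by move=> i j; rewrite hv.
Qed.

End SingularValues.
End Bochner.

(** * Row and column blocks, and the use of the rank hypothesis *)

Section Blocks.
Variables (R : realType) (k : scalar_kind) (H : hilbertType R k).
Local Notation F := (scalars R k).

Lemma rows_bmul m n p (I : {set 'I_m}) (A : 'M[H]_(m, n)) (M : 'M[F]_(n, p)) :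
  rows I (bmul A M) = bmul (rows I A) M.
Proof.
by apply/matrixP => i j; rewrite !mxE; apply: eq_bigr => l _; rewrite !mxE.
Qed.

Lemma cols_bmul m n p (J : {set 'I_p}) (A : 'M[H]_(m, n)) (M : 'M[F]_(n, p)) :
  cols J (bmul A M) = bmul A (cols J M).
Proof.
by apply/matrixP => i j; rewrite !mxE; apply: eq_bigr => l _; rewrite !mxE.
Qed.

Lemma rowsD m n (I : {set 'I_m}) (A B : 'M[H]_(m, n)) :
  rows I (A + B) = rows I A + rows I B.
Proof. by apply/matrixP => i j; rewrite !mxE. Qed.

Lemma colsD m n (J : {set 'I_n}) (A B : 'M[H]_(m, n)) :
  cols J (A + B) = cols J A + cols J B.
Proof. by apply/matrixP => i j; rewrite !mxE. Qed.

(** A product through $\mathbb{F}^r$ whose range has dimension $r$ loses nothing. If the columns of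
    [X] map to a basis of the range, then [M *m X] is injective, hence invertible; this yields both
    claims. *)
Lemma has_dim_bmul_range p q r (Ui : 'M[H]_(p, r)) (M : 'M[F]_(r, q)) :
  has_dim (range (bapp (bmul Ui M))) r ->
  (forall z, bapp Ui z = 0 -> z = 0) /\ exists X : 'M[F]_(q, r), M *m X = 1%:M.
Proof.
move=> [e [e_free rE]].
have /choice[x xE] i : exists x, bapp Ui (M *m x) = e i.
  have : range (bapp (bmul Ui M)) (e i).
    rewrite rE; exists (fun j => (j == i)%:R) => //.
    rewrite (bigD1 i) //= eqxx scale1r big1 ?addr0 // => j /negbTE ->.
    by rewrite scale0r.
  by case=> x _ <-; exists x; rewrite bapp_bmul.
pose X : 'M[F]_(q, r) := \matrix_(a, i) x i a 0.
have Xc c : bapp Ui (M *m X *m c) = \sum_i c i 0 *: e i.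
  rewrite -mulmxA.
  have -> : X *m c = \sum_i c i 0 *: x i.
    apply/colP => a; rewrite mxE summxE; apply: eq_bigr => i _.
    by rewrite !mxE mulrC.
  rewrite mulmx_sumr (lin_sum (bapp_lin Ui)); apply: eq_bigr => i _.
  by rewrite -scalemxAr (linZ (bapp_lin Ui)) xE.
have MXu : M *m X \in unitmx.
  rewrite -unitmx_tr -row_free_unit; apply: row_free_of_kernel => c cMX.
  apply/rowP => i; rewrite mxE; apply: (e_free (fun i => c 0 i)).
  have := Xc c^T; rewrite -[M *m X]trmxK -trmx_mul cMX trmx0.
  by rewrite (lin0 (bapp_lin Ui)) => h; rewrite [RHS]h;
    apply: eq_bigr => j _; rewrite mxE.
split=> [z Uz|]; last first.
  by exists (X *m invmx (M *m X)); rewrite mulmxA mulmxV.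
have zE := mulKVmx MXu z; rewrite -zE Xc in Uz.
rewrite -zE (_ : invmx _ *m z = 0) ?mulmx0 //.
by apply/colP => i; rewrite [RHS]mxE;
  apply: (e_free (fun i => (invmx (M *m X) *m z) i 0)).
Qed.

End Blocks.

Theorem theorem7p3 (R : realType) (k : scalar_kind) (H : hilbertType R k)
    (m n : nat) (A B E : 'M[H]_(m, n)) (hA : A = B + E) (hB : B != 0)
    (I : {set 'I_m}) (J : {set 'I_n})
    (r : nat) (U : 'M[H]_(m, r)) (s : 'I_r -> R)
    (V : 'M[scalars R k]_(n, r)) (hsvd : is_svd B U s V)
    (hrank : brank (rows I (cols J B)) = brank B)
    (phi : sym_gauge R) :
  let C := cols J A in
  let Rw := rows I A in
  let G := rows I (cols J A) in
  let nC := gauge_norm phi (cols J E) in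
  let nR := gauge_norm phi (rows I E) in
  let nG := gauge_norm phi (rows I (cols J E)) in
  let eta_r := op_norm (@dotH R k H #|I|) (@dotF R k r) (bpinv (rows I U)) in
  let eta_c := op_norm (@dotF R k r) (@dotF R k #|J|)
                 (cpinv (ctr (rows J V))) in
  let nGp := op_norm (@dotH R k H #|I|) (@dotF R k #|J|) (bpinv G) in
  gauge_norm phi (B - bmul C (colwise (bpinv G) Rw)) <=
    eta_r * nR + eta_c * nC + 3%:R * eta_r * eta_c * nG +
    nGp * (nR * nC + (eta_r * nR + eta_c * nC + eta_r * eta_c * nG) * nG).
Proof.
lazy zeta; set C := cols J A; set Rw := rows I A; set G := rows I C.
set nC := gauge_norm phi (cols J E); set nR := gauge_norm phi (rows I E).
set nG := gauge_norm phi (rows I (cols J E)).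
set eta_r := op_norm _ _ (bpinv (rows I U)).
set eta_c := op_norm _ _ (cpinv _).
set nGp := op_norm _ _ (bpinv G).
have [rB _ _ [s0 _] BE] := hsvd.
have [hu hv _ _ _] := svd_of_is_svd hsvd.
pose D := diag_mx (\row_i of_real k (s i)).
have GBE : rows I (cols J B) = bmul (rows I U) (D *m ctr (rows J V)).
  rewrite {1}BE cols_bmul rows_bmul; congr (bmul _ _).
  by apply/matrixP => i j; rewrite mxE !mul_diag_mx !mxE.
have CBE : cols J B = bmul U (D *m ctr (rows J V)).
  rewrite {1}BE cols_bmul; congr (bmul _ _).
  by apply/matrixP => i j; rewrite mxE !mul_diag_mx !mxE.
have RBE : rows I B = bmul (rows I U) (D *m ctr V) by rewrite {1}BE rows_bmul.
have [Uinj [X VX]] : (forall z, bapp (rows I U) z = 0 -> z = 0) /\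
    exists X, D *m ctr (rows J V) *m X = 1%:M.
  apply: has_dim_bmul_range; rewrite -GBE.
  have r0 : r <> 0%N.
    move=> r0; case/eqP: hB; rewrite BE; apply/matrixP => i j.
    by rewrite !mxE big1 // => l; move: (ltn_ord l); rewrite {2}r0.
  move: hrank; rewrite -rB /brank /Defs.dim.
  by case: xgetP => [d _ hd <- //|_ /esym].
pose SU := bpinv (rows I U); pose SV := cpinv (ctr (rows J V)).
pose SG := bpinv G.
have hHm := dotH_is_dot H m; have hHI := dotH_is_dot H #|I|.
have hFr := dotF_is_dot R k r; have hFn := dotF_is_dot R k n.
have hFJ := dotF_is_dot R k #|J|.
have lVJ : lin (fun x : 'cV[scalars R k]_#|J| => ctr (rows J V) *m x).
  by move=> a x y; rewrite mulmxDr scalemxAr.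
have [eta_r0 bSU] := op_norm_pinv hHI (bapp_lin (rows I U)).
have [eta_c0 bSV] := op_norm_pinv hFr lVJ.
have [nGp0 bSG] := op_norm_pinv hHI (bapp_lin G).
have pSU := is_pinvP hHI (bapp_lin (rows I U)).
have pSV := is_pinvP hFr lVJ.
have pSG := is_pinvP hHI (bapp_lin G).
rewrite -/SU -/eta_r in eta_r0 bSU pSU.
rewrite -/SV -/eta_c in eta_c0 bSV pSV.
rewrite -/SG -/nGp in nGp0 bSG pSG.
have [lSU TSTU _ _ _] := pSU.
have [lSV TSTV _ _ _] := pSV.
have [lSG TSTG _ _ _] := pSG.
have SUK z : SU (bapp (rows I U) z) = z.
  apply/eqP; rewrite -subr_eq0; apply/eqP/Uinj.
  by rewrite (linB (bapp_lin _)) TSTU subrr.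
have SVK z : ctr (rows J V) *m SV z = z.
  (* On the range of $V(J,:)^*$ the equation $TST = T$ gives the right inverse. Surjectivity comes
     from the right inverse [X] of [D *m ctr (rows J V)], after cancelling the positive diagonal of
     [D]. *)
  suff [x <-] : exists x, ctr (rows J V) *m x = z by rewrite TSTV.
  exists (X *m (D *m z)).
  have : D *m (ctr (rows J V) *m (X *m (D *m z))) = D *m z.
    by rewrite !mulmxA VX mul1mx.
  move=> DE; apply/colP => i; move/colP/(_ i): DE.
  rewrite !mul_diag_mx !mxE => /mulfI; apply.
  by rewrite of_real_eq0 gt_eqF.
pose P y := bapp U (SU y).
pose Q x := SV (ctr V *m x).
pose GE := rows I (cols J E); pose CE := cols J E; pose RE := rows I E.
pose XE z := bapp CE z - P (bapp GE z).
have lP : lin P by apply: lin_comp (bapp_lin U) lSU.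
have lQ : lin Q by apply: (lin_comp lSV) => a x y; rewrite mulmxDr scalemxAr.
have lXE : lin XE.
  move=> a x y; rewrite /XE !bapp_lin lP scalerBr opprD addrACA //.
have nC0 : 0 <= nC by apply: gauge_norm_ge0.
have nR0 : 0 <= nR by apply: gauge_norm_ge0.
have nG0 : 0 <= nG by apply: gauge_norm_ge0.
have bP : bounded_by (@dotH R k H #|I|) (@dotH R k H m) eta_r P.
  move=> y; apply: le_trans (bSU y).
  rewrite -(@ler_pXn2r _ 2) ?nnegrE ?dot_norm_ge0 // /P bapp_cols.
  rewrite (dot_norm_orthonormal_sum hHm hu) (dot_norm_sqr hFr) sre_sum.
  exact: lexx.
have bQ : bounded_by (@dotF R k n) (@dotF R k #|J|) eta_c Q.
  move=> x; apply: le_trans (bSV _) _; rewrite ler_wpM2l //.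
  rewrite -(@ler_pXn2r _ 2) ?nnegrE ?dot_norm_ge0 //.
  apply: le_trans (bessel hFn hv x); rewrite (dot_norm_sqr hFr) sre_sum.
  rewrite le_eqVlt; apply/orP; left; apply/eqP; apply: eq_bigr => i _.
  rewrite -/(nsq _); congr nsq; rewrite mxE; apply: eq_bigr => a _.
  by rewrite !mxE.
(* An operator-norm bound for $X = C_E - P G_E$, each block being bounded by its gauge norm. *)
pose c := nC + eta_r * nG.
have c0 : 0 <= c by rewrite addr_ge0 // mulr_ge0.
have bXE : bounded_by (@dotF R k #|J|) (@dotH R k H m) c XE.
  apply: (bounded_add hHm); first exact: gauge_norm_bounded.
  apply: (bounded_opp hHm); apply: bounded_comp => //.
  exact: gauge_norm_bounded.
have bGG := pinv_range_contraction hHI pSG.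
have bPGG := bounded_comp eta_r0 bP bGG.
have bXSG := bounded_comp c0 bXE bSG.
have bGQ := bounded_comp ler01 (pinv_corange_contraction pSG) bQ.
have lGQ : lin (fun x => SG (bapp G (Q x))).
  by apply: (lin_comp lSG); apply: lin_comp (bapp_lin G) lQ.
have lPGG : lin (fun y => P (bapp G (SG y))).
  by apply: (lin_comp lP); apply: lin_comp (bapp_lin G) lSG.
have lXSG : lin (fun y => XE (SG y)) by apply: lin_comp.
(* [S] is $CG^+$, split by $C = PG + X$: bounding $P(GG^+)$ and $XG^+$ separately keeps the size of
   $C$ out of the estimate. *)
pose S y := P (bapp G (SG y)) + XE (SG y).
have lS : lin S.
  move=> a x y; rewrite /S; have /= -> := lPGG a x y.
  by have /= -> := lXSG a x y; rewrite addrACA -scalerDr.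
have bS := bounded_add hHm bPGG bXSG; rewrite -/S in bS.
pose T1 y := - P y + S y.
have lT1 : lin T1.
  by move=> a x y; rewrite /T1 lP lS opprD -scalerN addrACA -scalerDr.
have bT1 := bounded_add hHm (bounded_opp hHm bP) bS; rewrite -/T1 in bT1.
pose T2 y := - S y.
have lT2 : lin T2 by move=> a x y; rewrite /T2 lS opprD scalerN.
have bT2 := bounded_opp hHm bS; rewrite -/T2 in bT2.
pose T3 (y : {ffun 'I_m -> H}) := - y.
have lT3 : lin T3 by move=> a x y; rewrite /T3 opprD scalerN.
have bT3 : bounded_by (@dotH R k H m) (@dotH R k H m) 1 T3.
  by move=> y; rewrite mul1r (dot_normN hHm).
(* The error is regrouped by block and right factor: $(S - P)G_E Q - S R_E - C_E G^+GQ + P G_E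
   G^+GQ$. *)
have key x : bapp (B - bmul C (colwise SG Rw)) x =
    T1 (bapp GE (Q x)) + T2 (bapp RE x) +
    (T3 (bapp CE (SG (bapp G (Q x)))) + P (bapp GE (SG (bapp G (Q x))))).
  have hG z : bapp G z = bapp (rows I (cols J B)) z + bapp GE z.
    by rewrite /G /C hA colsD rowsD bappD.
  have PGB z : P (bapp (rows I (cols J B)) z) = P (bapp G z) - P (bapp GE z).
    by rewrite hG (linD lP) addrK.
  have hC z : bapp C z = P (bapp G z) + XE z.
    rewrite /C hA colsD bappD /XE addrCA -PGB addrC; congr (_ + _).
    by rewrite /P GBE bapp_bmul SUK CBE bapp_bmul.
  have DQ : D *m (ctr (rows J V) *m Q x) = D *m (ctr V *m x) by rewrite SVK.
  have hR : bapp Rw x = bapp G (Q x) + (bapp RE x - bapp GE (Q x)).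
    rewrite /Rw hA rowsD bappD addrCA addrC hG addrK; congr (_ + _).
    by rewrite RBE GBE !bapp_bmul -!mulmxA DQ.
  have hBx : bapp B x = P (bapp G (Q x)) - P (bapp GE (Q x)).
    rewrite -PGB /P GBE bapp_bmul SUK -mulmxA DQ mulmxA.
    by rewrite {1}BE bapp_bmul.
  rewrite bappD bappN bapp_bmul (colwise_bapp _ _ lSG) hBx hR.
  (* By $GG^+G = G$, the term $SGQ$ equals $PGQ + XG^+GQ$, and its $PGQ$ cancels the one coming from
     $B$. *)
  rewrite hC -/(S _) (linD lS) (linB lS) {1}/S TSTG {1}/XE /T1 /T2 /T3.
  move: (S (bapp RE x)) (S (bapp GE (Q x))) => y z.
  rewrite -(addrA (P _) (_ - _)) opprD addrACA subrr add0r -!addrA.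
  congr (_ + _); rewrite !opprD !opprK addrA [LHS]addrC (addrC (- y)).
  by rewrite [LHS]addrC [RHS]addrC -addrA.
have lid : lin (fun y : 'cV[scalars R k]_n => y) by [].
have bid : bounded_by (@dotF R k n) (@dotF R k n) 1 id by move=> y; rewrite mul1r.
have [rG [uG [vG [hsG srG]]]] := singular_values_svd GE.
have [rR [uR [vR [hsR srR]]]] := singular_values_svd RE.
have [rC [uC [vC [hsC srC]]]] := singular_values_svd CE.
pose q := eta_r * 1 + c * nGp.
have q0 : 0 <= q by rewrite !addr_ge0 // !mulr_ge0.
have q1 : 0 <= eta_r + q by rewrite addr_ge0.
have e1 : 0 <= 1 * eta_c by rewrite mul1r.
have [z01 o1 o2 o3] : [/\ 0 <= (1 : R), 0 <= (eta_r + q) * eta_c, 0 <= q * 1 &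
    0 <= 1 * (1 * eta_c)].
  by rewrite ler01 !mulr_ge0.
have o4 : 0 <= eta_r * (1 * eta_c) by rewrite mulr_ge0.
(* The coefficients are the products of the bounds on the outer factors in [key]. The nesting and
   the factors 1 match the two-term form of [gauge_comb]. *)
pose x i := (eta_r + q) * eta_c * singular_values GE i +
  1 * (q * 1 * singular_values RE i + 1 * (1 * (1 * eta_c) * singular_values CE i +
  eta_r * (1 * eta_c) * singular_values GE i)).
have fG := singular_values_fin_supp GE.
have fR := singular_values_fin_supp RE.
have fC := singular_values_fin_supp CE.
have f1 := fin_supp_comb (1 * (1 * eta_c)) (eta_r * (1 * eta_c)) fC fG.
have f2 := fin_supp_comb (q * 1) 1 fR f1.
have fx := fin_supp_comb ((eta_r + q) * eta_c) 1 fG f2.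
apply: (@le_trans _ _ (phi x)).
  apply: gauge_norm_dominated => // [i|l g f hg hf].
    by rewrite /x !(addr_ge0, mulr_ge0) // ?singular_values_ge0.
  have sre_dot4 w (t1 t2 t3 t4 : {ffun 'I_m -> H}) :
      sre (dotH w (t1 + t2 + (t3 + t4))) =
      sre (dotH w t1) + sre (dotH w t2) + (sre (dotH w t3) + sre (dotH w t4)).
    by rewrite !(dotDr hHm) !sreD.
  under eq_bigr do rewrite key sre_dot4.
  have k1 := ky_fan hHI hHm hFn hsG srG lT1 lQ q1 eta_c0 bT1 bQ hg hf.
  have k2 := ky_fan hHI hHm hFn hsR srR lT2 lid q0 ler01 bT2 bid hg hf.
  have k3 := ky_fan hHm hHm hFn hsC srC lT3 lGQ ler01 e1 bT3 bGQ hg hf.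
  have k4 := ky_fan hHI hHm hFn hsG srG lP lGQ eta_r0 e1 bP bGQ hg hf.
  rewrite !big_split /=; apply: le_trans (lerD (lerD k1 k2) (lerD k3 k4)) _.
  rewrite !mulr_sumr -!big_split /=.
  by apply: ler_sum => i _; rewrite /x; lra.
(* With $q = \eta_r + c\|G^+\|$, the weights $(\eta_r + q)\eta_c$ and $\eta_r\eta_c$ of
   $\|G_E\|_\phi$ add up to $3\eta_r\eta_c + \eta_c c\|G^+\|$; expanding [c] gives exactly the
   claimed right side. *)
apply: (le_trans (gauge_comb phi o1 z01 fG f2)).
have := gauge_comb phi o2 z01 fR f1.
have := gauge_comb phi o3 o4 fC fG.
rewrite -/(gauge_norm phi GE) -/(gauge_norm phi RE) -/(gauge_norm phi CE).
rewrite -/nG -/nR -/nC /q /c => h1 h2.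
lra.
Qed.
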